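(* In the Poisson multigraph model on the vertex set $[n]$ (for each unordered pair $\{i,j\}$ of distinct vertices, infinitely many parallel edges with costs given by the points of an intensity-$1$ Poisson process on $(0,\infty)$, independent over pairs), let $T_1$ be the minimum spanning tree and, for $k\ge2$, let $T_k$ be the minimum spanning tree after deleting the edges of $T_1,\dots,T_{k-1}$, and let $w(T_k)$ be its total cost. Then for each $k\ge1$, $\mathbb E\, w(T_k)\to\gamma_k$ as $n\to\infty$, where $\gamma_k$ is the constant such that $w(T_k)\to\gamma_k$ in probability.
   Context: It is known (from the same paper) that for each $k\ge1$ there is a constant $\gamma_k$ with $w(T_k)\to\gamma_k$ in probability in this model as $n\to\infty$. *)

(* Defs.v *)
From HB Require Import structures.
From mathcomp Require Import all_boot all_order all_algebra.
From mathcomp Require Import all_classical all_reals all_analysis.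
Set Implicit Arguments. Unset Strict Implicit. Unset Printing Implicit Defensive.
Import Order.TTheory GRing.Theory Num.Theory.
Local Open Scope classical_set_scope.
Local Open Scope ring_scope.

(* An edge is a triple (i, j, m) with i < j: the m-th (0-based) parallel
   edge between i and j, i.e. the m-th point of the Poisson process of {i,j}. *)
Definition medge (n : nat) := ('I_n * 'I_n * nat)%type.

Definition valid_edge n (e : medge n) : bool := (e.1.1 < e.1.2)%N.

Definition adj n (F : seq (medge n)) : rel 'I_n :=
  fun x y => has (fun e : medge n =>
    ((e.1.1 == x) && (e.1.2 == y)) || ((e.1.1 == y) && (e.1.2 == x))) F.

(* F (a finite set of edges, as a duplicate-free list) is a spanning tree of
   the multigraph whose available edges are those satisfying A:
   it uses only available edges, it is connected on all of [n], and it is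
   acyclic (every edge is a bridge of F). *)
Definition spanning_tree n (A : pred (medge n)) (F : seq (medge n)) : Prop :=
  [/\ uniq F, all (@valid_edge n) F, all A F,
      (forall x y : 'I_n, connect (adj F) x y) &
      (forall e, e \in F -> ~~ connect (adj (rem e F)) e.1.1 e.1.2)].

Definition weight {R : numDomainType} n (c : medge n -> R) (F : seq (medge n)) : R :=
  \sum_(e <- F) c e.

Definition is_mst {R : numDomainType} n (A : pred (medge n)) (c : medge n -> R)
  (F : seq (medge n)) : Prop :=
  spanning_tree A F /\
  forall F', spanning_tree A F' -> weight c F <= weight c F'.

Definition successive_msts {R : numDomainType} n (c : medge n -> R)
  (Ts : seq (seq (medge n))) : Prop :=
  forall j, (j < size Ts)%N ->
    is_mst (fun e => all (fun T => e \notin T) (take j Ts)) c (nth [::] Ts j).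

Definition mutually_independent d (T : measurableType d) (R : realType)
  (P : probability T R) (I : eqType) (J : set I) (X : I -> T -> R) : Prop :=
  forall (F : seq I) (B : I -> set R),
    uniq F -> [set` F] `<=` J -> (forall i, measurable (B i)) ->
    P (\bigcap_(i in [set` F]) (X i @^-1` B i)) = (\prod_(i <- F) P (X i @^-1` B i))%E.

Definition exp1_rv d (T : measurableType d) (R : realType)
  (P : probability T R) (X : T -> R) : Prop :=
  measurable_fun setT X /\
  forall t : R, 0 <= t -> P [set x | t < X x] = (expR (- t))%:E.

(* The Poisson multigraph model on [n]: for each pair i < j, the costs of
   the parallel edges are the points S_0 < S_1 < ... of a rate-1 Poisson
   process on (0,oo), represented through its i.i.d. Exp(1) interarrival
   times G i j 0, G i j 1, ...; all these gaps are independent over pairs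
   and indices. *)
Definition poisson_multigraph d (T : measurableType d) (R : realType)
  (P : probability T R) n (G : 'I_n -> 'I_n -> nat -> T -> R) : Prop :=
  mutually_independent P (@valid_edge n) (fun e : medge n => G e.1.1 e.1.2 e.2) /\
  forall (i j : 'I_n) (m : nat), (i < j)%N -> exp1_rv P (G i j m).

(* cost of edge (i,j,m) = m-th point of the Poisson process of {i,j} *)
Definition edge_cost (R : realType) T n (G : 'I_n -> 'I_n -> nat -> T -> R)
  (x : T) (e : medge n) : R :=
  \sum_(l < e.2.+1) G e.1.1 e.1.2 l x.

(* Main.v *)
Require Import Defs.
From HB Require Import structures.
From mathcomp Require Import all_boot all_order all_algebra.
From mathcomp Require Import all_classical all_reals all_analysis.
From mathcomp Require Import measurable_realfun.
From mathcomp Require Import ring lra.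
Set Implicit Arguments.
Unset Strict Implicit.
Unset Printing Implicit Defensive.
Import Order.TTheory GRing.Theory Num.Theory.
Local Open Scope classical_set_scope.
Local Open Scope ring_scope.

(* Convergence in probability is upgraded to convergence of means by uniform
   integrability, which follows from a first-moment argument. Let tau_ij be the
   cost at which i and j get joined in what is left after removing T_1, ...,
   T_(k-1). A point of the process of {i,j} arriving in (t, tau_ij] lies in one of
   T_1, ..., T_k, and points arrive at rate 1, so E (tau_ij - t)^+ is at most the
   mean number of edges of {i,j} of cost > t in T_1, ..., T_k. Conversely, charging
   an edge of a tree to its end far from a root r is injective, so that n times the
   number of edges of cost > t in T_1, ..., T_k is at most k times the number of
   ordered pairs with tau_ij > t, and n times the sum of (c(e) - t)^+ over T_k is at
   most the sum of (tau_ij - t)^+ over ordered pairs. Taking t = 0 and then t = C/n,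
   with Markov's inequality in between, gives E (w(T_k) - C)^+ <= 4 k^2 / C. *)

(** The obstacle is that [tau] of a pair depends on the points of that very pair, so it cannot be
    compared directly with an independent exponential gap. In the m-th gap it is replaced by its
    value with the points m, m+1, ... of the pair deleted. That value is independent of the gap and
    at least the true one, and a point arriving before it still lies in one of the trees. For such
    an independent threshold, the mean of the minimum of gap and threshold is the probability that
    the gap ends first, which is the exact form of arrival at rate 1. Two devices keep everything
    finite. The first k trees use only the k cheapest parallel edges of each pair, so measurability
    reduces to the order of finitely many costs. The minimum defining [tau] is capped by a constant
    M, which is sent to infinity at the end. *)

(** * Connectivity in finite multigraphs *)

Section Multigraph.
Variable n : nat.
Implicit Types (e f : medge n) (F H : seq (medge n)) (x y z : 'I_n).

Definition conn F x y : bool := connect (adj F) x y.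

Definition connects F : Prop := forall x y, conn F x y.

Lemma adjP F x y :
  reflect (exists2 e, e \in F & (e.1.1 = x /\ e.1.2 = y) \/ (e.1.1 = y /\ e.1.2 = x))
          (adj F x y).
Proof.
apply: (iffP hasP) => -[e eF].
  by case/orP => /andP[/eqP ? /eqP ?]; exists e => //; [left|right].
by case=> -[<- <-]; exists e => //; rewrite !eqxx ?orbT.
Qed.

Lemma conn_sym F : symmetric (conn F).
Proof.
apply: sym_connect_sym => x y; apply/adjP/adjP => -[e eF]; rewrite or_comm => h; exists e => //.
Qed.

Lemma conn_refl F x : conn F x x. Proof. exact: connect0. Qed.

Lemma conn_trans F : transitive (conn F).
Proof. by move=> y x z; apply: connect_trans. Qed.

Lemma conn_ends F e : e \in F -> conn F e.1.1 e.1.2.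
Proof. by move=> eF; apply/connect1/adjP; exists e => //; left. Qed.

Lemma conn_endE F e x : e \in F -> conn F x e.1.1 = conn F x e.1.2.
Proof.
by move=> /conn_ends eF; apply/idP/idP => h; apply: conn_trans h _; rewrite // conn_sym.
Qed.

Lemma conn_lift F H x y :
  (forall e, e \in F -> conn H e.1.1 e.1.2) -> conn F x y -> conn H x y.
Proof.
move=> FH; apply: connect_sub => u v /adjP[e /FH eH [[<- <-] //|[<- <-]]].
by rewrite -/(conn H _ _) conn_sym.
Qed.

Lemma conn_sub F H x y : {subset F <= H} -> conn F x y -> conn H x y.
Proof. by move=> FH; apply: conn_lift => e /FH /conn_ends. Qed.

Lemma conn_closed (C : pred 'I_n) F x y :
  (forall e, e \in F -> C e.1.1 = C e.1.2) -> conn F x y -> C x = C y.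
Proof.
move=> FC /connectP[p]; elim: p x => [x _ -> //|z p IH x /= /andP[xz zp] yE].
by rewrite -(IH z zp yE); case/adjP: xz => e /FC eC [[<- <-]|[<- <-]].
Qed.

Lemma conn_crossing (C : pred 'I_n) F x y :
  conn F x y -> C x != C y -> exists2 e, e \in F & C e.1.1 != C e.1.2.
Proof.
move=> xy; apply: contra_neqP => h; apply: conn_closed xy => e eF.
by apply: contrapT => /eqP ne; apply: h; exists e.
Qed.

Lemma conn_split e F H x y : {subset F <= e :: H} -> conn F x y ->
  [|| conn H x y, conn H x e.1.1 && conn H y e.1.2 | conn H x e.1.2 && conn H y e.1.1].
Proof.
move=> FH.
(* [C] is the component of [x] once [e] is added to [H]; an edge of [F] has both ends in it or
   neither. *)
pose C z := [|| conn H x z, conn H x e.1.1 && conn H z e.1.2 | conn H x e.1.2 && conn H z e.1.1].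
rewrite -/(C y).
suff eC : forall f, f \in F -> C f.1.1 = C f.1.2.
  by move/(conn_closed eC) => <-; rewrite /C conn_refl.
move=> f /FH; rewrite inE => /orP[/eqP ->|fH].
  rewrite /C !conn_refl !andbT.
  by case: (conn H x e.1.1); case: (conn H x e.1.2); rewrite //= ?orbT.
have fE z : conn H z f.1.1 = conn H z f.1.2.
  by apply/idP/idP => h; apply: conn_trans h _; [|rewrite conn_sym]; apply: conn_ends.
by rewrite /C fE ![conn H f.1.1 _]conn_sym ![conn H f.1.2 _]conn_sym !fE.
Qed.

(** * Exchange properties of minimum spanning trees *)

Section Mst.
Variable R : realDomainType.
Variables (A : pred (medge n)) (c : medge n -> R).

(** Dropping an edge whose ends stay connected without it keeps connectedness and does not raise the
    weight. Exchange arguments thus need only check that a swapped edge set is connected, not that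
    it is acyclic. *)
Lemma spanning_subtree F : (forall e, e \in F -> 0 <= c e) ->
  uniq F -> all (@valid_edge n) F -> all A F -> connects F ->
  exists2 F', spanning_tree A F' & weight c F' <= weight c F.
Proof.
have [m] := ubnP (size F); elim: m F => // m IH F szF c0 uF vF aF cF.
have [/hasP[e eF ce]|/hasPn nb] := boolP (has (fun e => conn (rem e F) e.1.1 e.1.2) F).
  have sub : {subset rem e F <= F} by exact: mem_rem.
  have [||||||F' tF' wF'] := IH (rem e F).
  - by rewrite size_rem // -ltnS prednK //; case: (F) eF.
  - by move=> f /sub /c0.
  - exact: rem_uniq.
  - by apply/allP => f /sub; apply/allP.
  - by apply/allP => f /sub; apply/allP.
  - move=> x y; apply: conn_lift (cF x y) => f fF.
    have [-> //|fe] := eqVneq f e.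
    by apply: conn_ends; rewrite mem_rem_uniq // !inE fe.
  exists F' => //; apply: le_trans wF' _.
  by rewrite [leRHS]/weight (big_rem e) //= lerDr c0.
exists F => //; split=> // e eF; exact: nb.
Qed.

Hypothesis c_ge0 : forall e, valid_edge e -> 0 <= c e.
Variable F : seq (medge n).
Hypothesis mstF : is_mst A c F.

Let uF : uniq F. Proof. by case: mstF => -[]. Qed.
Let vF : {in F, forall e, valid_edge e}. Proof. by case: mstF => -[_ /allP]. Qed.
Let aF : {in F, forall e, A e}. Proof. by case: mstF => -[_ _ /allP]. Qed.
Let cF : connects F. Proof. by case: mstF => -[]. Qed.

Lemma mst_swap e f : e \in F -> f \notin rem e F -> valid_edge f -> A f ->
  connects (f :: rem e F) -> c e <= c f.
Proof.
move=> eF fF vf af cF'.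
have sub : {subset rem e F <= F} by exact: mem_rem.
have [|||||F' tF' wF'] := @spanning_subtree (f :: rem e F).
- by move=> g; rewrite inE => /orP[/eqP ->|/sub /vF] ; apply: c_ge0.
- by rewrite /= fF rem_uniq.
- by rewrite /= vf; apply/allP => g /sub /vF.
- by rewrite /= af; apply/allP => g /sub /aF.
- done.
have := le_trans (mstF.2 _ tF') wF'.
by rewrite /weight big_cons [leLHS](big_rem e) //= lerD2r.
Qed.

(** Cut property. Removing [e] splits the tree in two; a path of cheaper available edges between the
    ends of [e] would cross this cut, and its crossing edge could replace [e] at lower weight. *)
Lemma mst_cut e (s : seq (medge n)) : e \in F ->
  (forall f, f \in s -> [/\ valid_edge f, A f & c f < c e]) -> ~~ conn s e.1.1 e.1.2.
Proof.
move=> eF sP; apply/negP => es.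
have nb : ~~ conn (rem e F) e.1.1 e.1.2 by case: mstF => -[_ _ _ _ /(_ e eF)].
have [|f fs fC] := conn_crossing (C := conn (rem e F) e.1.1) es.
  by rewrite conn_refl (negbTE nb).
have [vf af] := sP f fs; apply/negP; rewrite -leNgt; apply: mst_swap => //.
  by apply/negP => /(@conn_endE _ _ e.1.1) h; rewrite h eqxx in fC.
have sub : {subset rem e F <= f :: rem e F} by move=> g; rewrite inE => ->; rewrite orbT.
have FH : {subset F <= e :: rem e F}.
  by move=> g gF; rewrite inE mem_rem_uniq // !inE gF andbT; case: (g == e).
have two z : conn (rem e F) e.1.1 z || conn (rem e F) e.1.2 z.
  have := conn_split FH (cF e.1.1 z); rewrite conn_refl (negbTE nb) /=.
  by rewrite orbF [conn _ z _]conn_sym.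
have eF' : conn (f :: rem e F) e.1.1 e.1.2.
  have ff : conn (f :: rem e F) f.1.1 f.1.2 by apply: conn_ends; rewrite mem_head.
  case: (boolP (conn (rem e F) e.1.1 f.1.1)) fC => h1 /=.
    rewrite eq_sym eqb_id => h2; have := two f.1.2; rewrite (negbTE h2) /= => h3.
    apply: conn_trans (conn_sub sub h1) _; apply: conn_trans ff _.
    by rewrite conn_sym (conn_sub sub h3).
  rewrite eq_sym eqbF_neg negbK => h2; have := two f.1.1; rewrite (negbTE h1) /= => h3.
  apply: conn_trans (conn_sub sub h2) _; rewrite conn_sym.
  by apply: conn_trans (conn_sub sub h3) _.
move=> x y; apply: conn_lift (cF x y) => g gF.
have [-> //|ge] := eqVneq g e.
by apply: conn_ends; rewrite inE mem_rem_uniq // !inE ge gF orbT.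
Qed.

(** Cycle property. To avoid explicit paths, the tree edges costlier than [e] are deleted one at a
    time: if deleting [f] separated the ends of [e], then [e] could replace [f], forcing
    [c f <= c e]. *)
Lemma mst_conn e : valid_edge e -> A e -> e \notin F ->
  conn [seq f <- F | c f <= c e] e.1.1 e.1.2.
Proof.
move=> ve ae eF.
suff main (s : seq (medge n)) : all (fun f => c e < c f) s -> {subset s <= F} ->
    conn [seq f <- F | f \notin s] e.1.1 e.1.2.
  have := main [seq f <- F | c e < c f] (filter_all _ _) (mem_subseq (filter_subseq _ _)).
  apply: conn_sub => f; rewrite !mem_filter negb_and => /andP[h fF].
  by move: h; rewrite fF orbF -leNgt andbT.
elim: s => [|f s IH] /= => [_ _|/andP[ef es] sF].
  by apply: conn_sub (cF e.1.1 e.1.2) => f fF; rewrite mem_filter fF.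
have {}IH := IH es (fun g gs => sF g (mem_behead (s := f :: s) gs)).
pose H := [seq g <- F | g \notin f :: s]; rewrite -/H; apply/idPn => nH.
have fF : f \in F by apply: sF; rewrite mem_head.
have subH : {subset H <= e :: rem f F}.
  move=> g; rewrite mem_filter inE negb_or => /andP[/andP[gf _] gF].
  by rewrite inE mem_rem_uniq // !inE gf gF orbT.
have sp : {subset [seq f <- F | f \notin s] <= f :: H}.
  move=> g; rewrite mem_filter inE => /andP[gs gF].
  by rewrite mem_filter inE negb_or gs gF andbT andbT; case: (g == f).
suff : c f <= c e by rewrite leNgt ef.
apply: mst_swap => //.
  by apply: contraNN eF => /mem_rem.
have ee : conn (e :: rem f F) e.1.1 e.1.2 by apply: conn_ends; rewrite mem_head.
have ff : conn (e :: rem f F) f.1.1 f.1.2.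
  have := conn_split sp IH; rewrite (negbTE nH) /= => /orP[] /andP[h1 h2].
    apply: conn_trans (_ : conn _ e.1.1 _); first by rewrite conn_sym (conn_sub subH h1).
    by apply: conn_trans ee _; apply: conn_sub h2.
  apply: conn_trans (_ : conn _ f.1.1 e.1.2) _; first by rewrite conn_sym (conn_sub subH h2).
  apply: conn_trans (conn_sub subH h1); by rewrite conn_sym.
move=> x y; apply: conn_lift (cF x y) => g gF.
have [-> //|gf] := eqVneq g f.
by apply: conn_ends; rewrite inE mem_rem_uniq // !inE gf gF orbT.
Qed.

End Mst.

(** * Charging tree edges to vertices *)

Section FarEnd.
Variables (A : pred (medge n)) (F : seq (medge n)).
Hypothesis treeF : spanning_tree A F.

Definition far (r : 'I_n) (e : medge n) : 'I_n :=
  if conn (rem e F) r e.1.1 then e.1.2 else e.1.1.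

Lemma farP r e : e \in F -> ~~ conn (rem e F) r (far r e).
Proof.
case: treeF => _ _ _ _ br eF; rewrite /far; case: ifPn => // h.
apply: contraNN (br e eF) => h2; rewrite -/(conn _ _ _).
by rewrite conn_sym in h; apply: conn_trans h h2.
Qed.

Lemma far_neq r e : e \in F -> far r e != r.
Proof. by move=> /farP - /(_ r); apply: contraNneq => ->; rewrite conn_refl. Qed.

(** If [e] and [f] had the same far end, then both ends of [e] would be cut off from [r] without
    [f], and conversely. The component of [r] in [F] minus both edges would then be closed under all
    edges of [F], hence contain every vertex, even the far end. *)
Lemma far_inj r : {in F &, injective (far r)}.
Proof.
move=> e f eF fF vE; apply/eqP/contraT => ef.
have uF : uniq F by case: treeF.
have cF : connects F by case: treeF.
pose S := [seq g <- F | (g != e) && (g != f)].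
have eNS : ~~ conn (rem e F) r (far r e) by exact: farP.
have fNS : ~~ conn (rem f F) r (far r e) by rewrite vE; exact: farP.
have eIf : conn (rem f F) e.1.1 e.1.2.
  by apply: conn_ends; rewrite mem_rem_uniq // !inE ef.
have fIe : conn (rem e F) f.1.1 f.1.2.
  by apply: conn_ends; rewrite mem_rem_uniq // !inE eq_sym ef.
have Se : {subset S <= rem e F}.
  by move=> g; rewrite mem_filter mem_rem_uniq // !inE => /andP[/andP[-> _] ->].
have Sf : {subset S <= rem f F}.
  by move=> g; rewrite mem_filter mem_rem_uniq // !inE => /andP[/andP[_ ->] ->].
have end_e (u w : 'I_n) H : ~~ conn H r u -> conn H u w -> ~~ conn H r w.
  by move=> h uw; apply: contraNN h => h; apply: conn_trans h _; rewrite conn_sym.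
have fare g : far r g = g.1.1 \/ far r g = g.1.2 by rewrite /far; case: ifP; [right|left].
have ee : ~~ conn (rem f F) r e.1.1 /\ ~~ conn (rem f F) r e.1.2.
  by case: (fare e) => h; rewrite h in fNS; split=> //; apply: end_e fNS _; rewrite // conn_sym.
have ff : ~~ conn (rem e F) r f.1.1 /\ ~~ conn (rem e F) r f.1.2.
  rewrite vE in eNS.
  by case: (fare f) => h; rewrite h in eNS; split=> //; apply: end_e eNS _; rewrite // conn_sym.
have rS : ~~ conn S r (far r e) by apply: contraNN eNS; exact: conn_sub.
case/negP: rS; rewrite -(conn_closed (C := conn S r) _ (cF r _)) ?conn_refl //.
move=> g gF; have [->|ge] := eqVneq g e.
  by rewrite !(negbTE (contraNN (conn_sub Sf) _)) //; case: ee.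
have [->|gf] := eqVneq g f.
  by rewrite !(negbTE (contraNN (conn_sub Se) _)) //; case: ff.
by apply: conn_endE; rewrite mem_filter ge gf.
Qed.

(* Each edge is charged to its end far from the root, so that a tree edge
   of cost c pays for a vertex that is cut off from the root below cost c. *)
Lemma tree_sum_le (R : realDomainType) r (h : medge n -> R) (g : 'I_n -> R) :
  (forall v, 0 <= g v) -> {in F, forall e, h e <= g (far r e)} ->
  \sum_(e <- F) h e <= \sum_(v | v != r) g v.
Proof.
move=> g0 hg.
have uF : uniq F by case: treeF.
apply: (@le_trans _ _ (\sum_(v <- [seq far r e | e <- F]) g v)).
  by rewrite big_map big_seq [leRHS]big_seq; apply: ler_sum.
have us : uniq [seq far r e | e <- F] by rewrite map_inj_in_uniq //; exact: far_inj.
rewrite (big_uniq _ us) /= [leRHS](bigID (mem [seq far r e | e <- F])) /=.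
apply: ler_wpDr; first exact: sumr_ge0.
rewrite le_eqVlt; apply/orP; left; apply/eqP; apply: eq_bigl => v.
apply/idP/idP => [h1|/andP[] //]; rewrite h1 andbT.
by case/mapP: h1 => e eF ->; exact: far_neq.
Qed.

End FarEnd.
End Multigraph.

(** * Kruskal layers and joining costs over a finite edge set *)

Section Levels.
Variables (n : nat) (E : finType) (emb : E -> medge n) (R : realDomainType).
Implicit Types (S : {set E}) (c : E -> R) (o : {set E * E}) (e f g : E).

Definition econn S x y : bool := conn [seq emb e | e in S] x y.

Lemma econn_lift S (F : seq (medge n)) x y :
  (forall e, e \in S -> conn F (emb e).1.1 (emb e).1.2) -> econn S x y -> conn F x y.
Proof. by move=> h; apply: conn_lift => _ /fintype.imageP[e eS ->]; exact: h. Qed.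

Lemma econn_sub S S' x y : {subset S <= S'} -> econn S x y -> econn S' x y.
Proof. by move=> h; apply: econn_lift => e /h eS; apply/conn_ends/fintype.image_f. Qed.

Lemma econn_sym S x y : econn S x y = econn S y x.
Proof. exact: conn_sym. Qed.

(* The successive Kruskal layers only depend on the order o of the costs;
   keeping o explicit is what makes them measurable. *)
Definition oleft o S : {set E} :=
  [set e in S | econn [set f in S | (f, e) \in o] (emb e).1.1 (emb e).1.2].

Definition olev o j S : {set E} := iter j (oleft o) S.

Definition cost_order c : {set E * E} := [set p | c p.1 < c p.2].

(* The least cost at which x and y get joined in the j-th left-over of S; the cap
   M is its value when they never are. *)
Definition otau o c (M : R) j S x y : R :=
  \big[Num.min/M]_(f in S | econn [set g in olev o j S | (f, g) \notin o] x y) c f.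

Notation left c := (oleft (cost_order c)).
Notation lev c := (olev (cost_order c)).

Definition tau c := otau (cost_order c) c.

Lemma olevS o j S : olev o j.+1 S = oleft o (olev o j S).
Proof. by []. Qed.

Lemma in_left c S e : e \in left c S =
  (e \in S) && econn [set f in S | c f < c e] (emb e).1.1 (emb e).1.2.
Proof.
rewrite inE; congr (_ && econn _ _ _).
by apply/setP => f; rewrite !inE.
Qed.

Lemma oleft_sub o S : {subset oleft o S <= S}.
Proof. by move=> e; rewrite inE => /andP[]. Qed.

(** A larger set offers more cheaper edges to join the ends of [e], so an edge passed over by
    Kruskal stays passed over. This is what makes [tau] decrease when edges are added. *)
Lemma oleft_mono o S S' : {subset S <= S'} -> {subset oleft o S <= oleft o S'}.
Proof.
move=> SS' e; rewrite !inE => /andP[/SS' -> /=]; apply: econn_sub => f.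
by rewrite !inE => /andP[/SS' ->].
Qed.

Lemma olev_mono o j S S' : {subset S <= S'} -> {subset olev o j S <= olev o j S'}.
Proof. by move=> SS'; elim: j => //= j; apply: oleft_mono. Qed.

Lemma olev_le o i j S : (i <= j)%N -> {subset olev o j S <= olev o i S}.
Proof.
elim: j => [|j IH]; first by rewrite leqn0 => /eqP ->.
rewrite leq_eqVlt => /predU1P[-> //|]; rewrite ltnS => /IH h e.
by move=> /oleft_sub; exact: h.
Qed.

Lemma olev_sub o j S : {subset olev o j S <= S}.
Proof. exact: (@olev_le o 0 j S). Qed.

Lemma lev_ext c c' j S : {in S, c =1 c'} -> lev c j S = lev c' j S.
Proof.
move=> cc'; elim: j => //= j IH; rewrite -/(lev c j S) -/(lev c' j S) -IH.
apply/setP => e; rewrite !in_left.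
have [el|//] := boolP (e \in lev c j S).
congr (_ && econn _ _ _); apply/setP => f; rewrite !inE.
have eS := olev_sub el.
by have [fl|//] := boolP (f \in lev c j S); have fS := olev_sub fl; rewrite !cc'.
Qed.

(** Kruskal decides on an edge by looking only at cheaper ones, so truncation at [t] commutes with
    taking layers. *)
Lemma lev_below c j S t :
  lev c j [set e in S | c e < t] = [set e in lev c j S | c e < t].
Proof.
elim: j => //= j IH; rewrite -/(lev c j S) -/(lev c j _) IH.
apply/setP => e; rewrite in_left !inE -andbA.
have [el|//] := boolP (e \in lev c j S); have [et|] := ltP (c e) t; last by rewrite andbF.
rewrite andbT /=; congr econn; apply/setP => f; rewrite !inE -andbA; congr (_ && _).
by apply/andP/idP => [[]//|fe]; split=> //; exact: lt_trans et.
Qed.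

Lemma in_otau_set c j S f : [set g in lev c j S | (f, g) \notin cost_order c] =
  [set g in lev c j S | c g <= c f].
Proof. by apply/setP => g; rewrite !inE -leNgt. Qed.

Lemma tau_le c M j S x y f : f \in S ->
  econn [set g in lev c j S | c g <= c f] x y -> tau c M j S x y <= c f.
Proof.
move=> fS h; apply: (bigmin_le_cond _ (fun f => c f)).
by rewrite fS in_otau_set.
Qed.

Lemma tau_le_cap c M j S x y : tau c M j S x y <= M.
Proof. exact: bigmin_le_id. Qed.

Lemma tau_ge c M j S x y (m : R) : m <= M ->
  (forall f, f \in S -> econn [set g in lev c j S | c g <= c f] x y -> m <= c f) ->
  m <= tau c M j S x y.
Proof.
move=> mM h; apply/bigmin_geP; split=> // f /andP[fS].
by rewrite in_otau_set; exact: h.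
Qed.

Lemma tau_cap_mono c M M' j S x y : M <= M' -> tau c M j S x y <= tau c M' j S x y.
Proof.
move=> MM'; apply: tau_ge => [|f fS]; first exact: le_trans (tau_le_cap _ _ _ _ _ _) _.
exact: tau_le.
Qed.

Lemma tau_sub c M j S S' x y : {subset S <= S'} -> tau c M j S' x y <= tau c M j S x y.
Proof.
move=> SS'; apply: tau_ge => [|f fS h]; first exact: tau_le_cap.
apply: tau_le; first exact: SS'.
by apply: econn_sub h => g; rewrite !inE => /andP[/(olev_mono SS') -> ->].
Qed.

Lemma tau_lev_le c M i j S x y : (i <= j)%N -> tau c M i S x y <= tau c M j S x y.
Proof.
move=> ij; apply: tau_ge => [|f fS h]; first exact: tau_le_cap.
apply: tau_le => //.
by apply: econn_sub h => g; rewrite !inE => /andP[/(olev_le ij) -> ->].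
Qed.

Lemma tau_sym c M j S x y : tau c M j S x y = tau c M j S y x.
Proof. by apply: eq_bigl => f; rewrite econn_sym. Qed.

Lemma tau_ext c c' M j S x y : {in S, c =1 c'} -> tau c M j S x y = tau c' M j S x y.
Proof.
move=> cc'; apply: eq_big => [f|f /andP[/cc' //]].
have [fS|//] := boolP (f \in S); rewrite !in_otau_set (lev_ext _ cc').
congr econn; apply/setP => g; rewrite !inE.
by have [/olev_sub gS|//] := boolP (g \in _); rewrite !cc'.
Qed.

(** The dearest edge of the connecting set gives the strict bound; [x != y] makes that set
    nonempty. *)
Lemma tau_lt c M j S x y t : x != y ->
  econn [set g in lev c j S | c g < t] x y -> tau c M j S x y < t.
Proof.
move=> xy; set L := [set g in _ | _] => h.
have [g0 g0L|L0] := pickP (mem L); last first.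
  case/negP: xy; apply/eqP.
  suff : pred1 x x = pred1 x y by rewrite /= eqxx => /esym/eqP.
  by apply: (conn_closed _ h) => g /fintype.imageP[e eL _]; have := L0 e; rewrite /= eL.
pose f := [arg max_(f > g0 | f \in L) c f]%O.
have [fL fmax] : f \in L /\ forall g, g \in L -> c g <= c f.
  by rewrite /f; case: arg_maxP.
have := fL; rewrite inE => /andP[/olev_sub fS ft].
apply: le_lt_trans ft; apply: tau_le => //.
apply: econn_sub h => g gL; have := gL; rewrite !inE => /andP[-> _] /=; exact: fmax.
Qed.

End Levels.

Notation lev emb c := (olev emb (cost_order c)).

(** * Truncation to K parallel edges; Kruskal layers as successive trees *)

(** Finite replacement for [medge]: by [mst_index_le] the first K trees use only edges numbered
    below K. *)
Definition kedge (n K : nat) := ('I_n * 'I_n * 'I_K)%type.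

Definition kemb n K (e : kedge n K) : medge n := (e.1.1, e.1.2, e.2 : nat).

Definition kfull n K : {set kedge n K} := [set e | valid_edge (kemb e)].

Lemma kemb_inj n K : injective (@kemb n K).
Proof. by move=> [[i j] m] [[i' j'] m'] [-> -> /val_inj ->]. Qed.

Lemma sum_seq_le (R : realDomainType) (I : eqType) (s t : seq I) (F : I -> R) :
  uniq s -> uniq t -> {subset s <= t} -> (forall i, 0 <= F i) ->
  \sum_(i <- s) F i <= \sum_(i <- t) F i.
Proof.
move=> us ut st F0; rewrite [leRHS](bigID (mem s)) /=; apply: ler_wpDr.
  exact: sumr_ge0.
rewrite le_eqVlt; apply/orP; left; apply/eqP; rewrite -[RHS]big_filter.
apply: perm_big; apply: uniq_perm => // [|i]; first exact: filter_uniq.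
by rewrite mem_filter; apply/idP/andP => [is_|[]//]; split=> //; exact: st.
Qed.

Section Kruskal.
Variables (n K : nat) (R : realDomainType) (c : medge n -> R).
Hypothesis c_gt0 : forall e, valid_edge e -> 0 < c e.
Hypothesis c_incr : forall (i j : 'I_n) m, (i < j)%N -> c (i, j, m) < c (i, j, m.+1).
Hypothesis c_inj : {in kfull n K &, injective (fun e => c (kemb e))}.
Variable Ts : seq (seq (medge n)).
Hypothesis szT : size Ts = K.
Hypothesis mstT : successive_msts c Ts.

Notation T j := (nth [::] Ts j).
Notation cK := (fun e => c (kemb e)).
Notation full := (kfull n K).
Notation levK j := (olev (@kemb n K) (cost_order cK) j).
Notation tauK M j := (tau (@kemb n K) cK M j full).

Definition avail j (e : medge n) : bool := all (fun T => e \notin T) (take j Ts).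

Let c_ge0 e : valid_edge e -> 0 <= c e. Proof. by move/c_gt0/ltW. Qed.

Let mstTj j : (j < K)%N -> is_mst (avail j) c (T j).
Proof. by rewrite -szT; exact: mstT. Qed.

Let treeT j : (j < K)%N -> spanning_tree (avail j) (T j).
Proof. by move/mstTj => -[]. Qed.

Lemma mst_valid j e : (j < K)%N -> e \in T j -> valid_edge e.
Proof. by move=> jK; case: (treeT jK) => _ /allP h _ _ _; apply: h. Qed.

Lemma mst_avail j e : (j < K)%N -> e \in T j -> avail j e.
Proof. by move=> jK; case: (treeT jK) => _ _ /allP h _ _; apply: h. Qed.

Lemma not_avail j e : (j <= K)%N -> ~~ avail j e -> exists2 i, (i < j)%N & e \in T i.
Proof.
move=> jK /allPn[F /(nthP [::])[i ij <-]]; rewrite negbK.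
have szj : size (take j Ts) = j by rewrite size_takel // szT.
by rewrite szj in ij; rewrite nth_take // => ei; exists i.
Qed.

Lemma availS j e : (j < K)%N -> avail j.+1 e = avail j e && (e \notin T j).
Proof.
by move=> jK; rewrite /avail (take_nth [::]) ?szT // all_rcons andbC.
Qed.

(** By the cut property, a parallel edge enters tree j only if its cheaper predecessor is no longer
    available, hence lies in an earlier tree; then induction applies. *)
Lemma mst_index_le j e : (j < K)%N -> e \in T j -> (e.2 <= j)%N.
Proof.
elim/ltn_ind: j e => j IH [[a b] [//|m]] jK eT /=.
have ab : (a < b)%N := mst_valid jK eT.
have [av|/(not_avail (ltnW jK))[i ij fi]] := boolP (avail j (a, b, m)); last first.
  have mi := IH i ij _ (ltn_trans ij jK) fi; exact: leq_ltn_trans mi ij.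
have ab1 : conn [:: (a, b, m)] a b by apply: (@conn_ends _ _ (a, b, m)); rewrite mem_head.
have := mst_cut c_ge0 (mstTj jK) (s := [:: (a, b, m)]) eT; rewrite ab1 => h.
suff : false by []; apply: h => f; rewrite inE => /eqP ->; split=> //; exact: c_incr.
Qed.

Lemma mst_kemb j e : (j < K)%N -> e \in T j -> exists2 f, f \in full & e = kemb f.
Proof.
move=> jK eT; have := mst_valid jK eT; have := mst_index_le jK eT.
case: e eT => [[a b] m] eT /= mj ab.
by exists (a, b, Ordinal (leq_ltn_trans mj jK)); rewrite ?inE.
Qed.

(** The cut property keeps surviving edges out of the tree; the cycle property shows that an
    available edge outside the tree survives. Injectivity of the costs turns the weak inequality of
    the latter into the strict one used by [oleft]. *)
Lemma mem_lev_avail j e : (j <= K)%N -> e \in full -> (e \in levK j full) = avail j (kemb e).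
Proof.
elim: j e => [|j IH] e jK eF; first by rewrite /avail take0 eF.
rewrite olevS in_left IH ?(ltnW jK) // availS //.
have [av|//] := boolP (avail j (kemb e)); rewrite /=.
have ve : valid_edge (kemb e) by rewrite inE in eF.
apply/idP/idP => [h|eT].
  apply/negP => eT; move: h; apply/negP; apply: (mst_cut c_ge0 (mstTj jK) eT).
  move=> _ /fintype.imageP[f fl ->]; move: fl; rewrite inE => /andP[fl cf].
  have fF := olev_sub fl; split=> //; first by rewrite inE in fF.
  by rewrite -IH ?(ltnW jK).
have := mst_conn c_ge0 (mstTj jK) ve av eT; apply: conn_sub => f.
rewrite mem_filter => /andP[cf fT]; have [f' f'F fE] := mst_kemb jK fT.
rewrite fE; apply: fintype.image_f; rewrite inE IH ?(ltnW jK) // -fE (mst_avail jK) //=.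
rewrite lt_neqAle cf andbT; apply: contraNneq eT => cfe.
have -> : e = f' by apply: c_inj => //; rewrite -fE cfe.
by rewrite -fE.
Qed.

(** A left-over edge cheaper than [e] is either a tree edge other than [e], or has its ends joined
    by tree edges no costlier than itself, so not by [e]. Below cost [c e] the root therefore cannot
    reach the far end of [e]. *)
Lemma tau_far j M (e : medge n) r : (j < K)%N -> e \in T j ->
  Num.min (c e) M <= tauK M j r (far (T j) r e).
Proof.
move=> jK eT; apply: tau_ge => [|f fF h]; first by rewrite ge_min lexx orbT.
rewrite ge_min; apply/orP; left; rewrite leNgt; apply/negP => fe.
case/negP: (farP (treeT jK) r eT); apply: econn_lift h => g.
have uT : uniq (T j) by case: (treeT jK).
rewrite inE => /andP[gl gf]; have gF := olev_sub gl.
have [gT|gT] := boolP (kemb g \in T j).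
  apply: conn_ends; rewrite mem_rem_uniq // !inE gT andbT.
  by apply: contraTneq (le_lt_trans gf fe) => ->; rewrite ltxx.
have := mst_conn c_ge0 (mstTj jK) _ _ gT.
rewrite -mem_lev_avail // ?(ltnW jK) // => hc.
have {}hc := hc _ gl; rewrite inE in gF; apply: conn_sub (hc gF) => x.
rewrite mem_filter mem_rem_uniq // !inE => /andP[xg ->]; rewrite andbT.
by apply: contraTneq (le_lt_trans (le_trans xg gf) fe) => ->; rewrite ltxx.
Qed.

Lemma not_lev e : e \in full -> e \notin levK K full -> exists2 j, (j < K)%N & kemb e \in T j.
Proof. by move=> eF; rewrite mem_lev_avail //; exact: not_avail. Qed.

(** All K trees are compared with the single level [K.-1], since [tau] grows with the level. The
    hypothesis [t < M] prevents the cap from hiding a value above [t]. *)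
Lemma sum_not_lev_le (t M : R) : t < M ->
  n%:R * (\sum_(e in full) ((e \notin levK K full) && (t < cK e)%R)%:R)
   <= K%:R * \sum_r \sum_(v | v != r) (t < tauK M K.-1 r v)%R%:R :> R.
Proof.
move=> tM.
have K0 : (0 < K)%N -> forall j, (j < K)%N -> (j <= K.-1)%N by case: (K).
set B := \sum_r _.
have tree j : (j < K)%N -> n%:R * (\sum_(e <- T j) (t < c e)%R%:R) <= B.
  move=> jK; rewrite -[n in n%:R]card_ord -sumr_const mulr_suml; apply: ler_sum => r _.
  rewrite mul1r; apply: (tree_sum_le (treeT jK)) => [v|e eT]; first exact: ler0n.
  rewrite ler_nat; have [te|//] := ltP t (c e); rewrite lt0b.
  apply: lt_le_trans (tau_lev_le _ _ _ _ _ _ (K0 (leq_ltn_trans (leq0n j) jK) j jK)).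
  by apply: lt_le_trans (tau_far _ _ jK eT); rewrite lt_min te.
suff h : \sum_(e in full) ((e \notin levK K full) && (t < cK e)%R)%:R <=
     \sum_(j < K) \sum_(e <- T j) (t < c e)%R%:R :> R.
  apply: le_trans (ler_wpM2l (ler0n _ _) h) _; rewrite mulr_sumr.
  have -> : K%:R * B = \sum_(j < K) B by rewrite sumr_const card_ord mulr_natl.
  by apply: ler_sum => j _; exact: tree.
apply: (@le_trans _ _ (\sum_(j < K) \sum_(e in full | kemb e \in T j) (t < cK e)%R%:R)).
  under [leRHS]eq_bigr do rewrite big_mkcondr.
  rewrite exchange_big /=; apply: ler_sum => e eF.
  have [el|el] := boolP (e \in _) => /=.
    by apply: sumr_ge0 => j _; case: ifP.
  have [j jK ej] := not_lev eF el.
  rewrite (bigD1 (Ordinal jK)) //= ej lerDl; apply: sumr_ge0 => i _; case: ifP => //.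
apply: ler_sum => j _; have jK := ltn_ord j.
rewrite -big_enum_cond /= -big_filter -(big_map (@kemb n K) xpredT (fun e => (t < c e)%R%:R)).
apply: sum_seq_le => [||x /mapP[e]|//].
- rewrite (map_inj_uniq (@kemb_inj n K)); apply: filter_uniq; exact: enum_uniq.
- by case: (treeT jK).
- by rewrite mem_filter => /andP[ej _] ->.
Qed.

Lemma mst_weight_le (t C M : R) : (0 < K)%N -> n%:R * t <= C -> 0 <= t ->
  (forall e, e \in full -> cK e <= M) ->
  n%:R * Num.max (weight c (T K.-1) - C) 0 <=
  \sum_r \sum_(v | v != r) Num.max (tauK M K.-1 r v - t) 0.
Proof.
move=> K0 tC t0 cM; have jK : (K.-1 < K)%N by rewrite prednK.
rewrite -[n in n%:R]card_ord -sumr_const mulr_suml; apply: ler_sum => r _; rewrite mul1r.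
(* The same charging with constant weight 1 bounds the number of tree edges. *)
have size_le : (size (T K.-1))%:R <= n%:R :> R.
  have := tree_sum_le (treeT jK) (r := r) (h := fun=> 1) (g := fun=> 1 : R) (fun=> ler01).
  rewrite sumr_const big_const_seq count_predT iter_addr_0 => /(_ (fun _ _ => lexx _)) h.
  apply: le_trans h _; rewrite ler_nat; apply: leq_trans (max_card _) _; by rewrite card_ord.
rewrite ge_max; apply/andP; split; last by apply: sumr_ge0 => v _; rewrite le_max lexx orbT.
apply: le_trans (tree_sum_le (treeT jK) (r := r)
  (h := fun e => Num.max (c e - t) 0) (g := fun v => Num.max (tauK M K.-1 r v - t) 0) _ _).
- rewrite lerBlDr /weight.
  apply: (@le_trans _ _ (\sum_(e <- T K.-1) (Num.max (c e - t) 0 + t))).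
    by apply: ler_sum => e _; rewrite -lerBlDr le_max lexx.
  rewrite big_split lerD2l big_const_seq count_predT iter_addr_0 -mulr_natl.
  by apply: le_trans (ler_wpM2r t0 size_le) tC.
- by move=> v; rewrite le_max lexx orbT.
- move=> e eT; have [f fF fE] := mst_kemb jK eT.
  have := tau_far M r jK eT; rewrite (min_idPl _); last by rewrite fE cM.
  by move=> h; rewrite ge_max !le_max lerD2r h lexx orbT.
Qed.

End Kruskal.

(** * Splitting the excess of [tau] along the gaps of one pair *)

(** All terms are lengths inside the gap from [a] to [a + x]: the part between [t] and [u], plus the
    part below [t], is at most the part below the maximum of [v] and [t]. *)
Lemma clamp_step (R : realDomainType) (a x u v t : R) : 0 < x -> u <= v ->
  Num.max (Num.min (a + x) u - t) 0 - Num.max (Num.min a u - t) 0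
   + Num.min x (Num.max (t - a) 0) <= Num.min x (Num.max (Num.max v t - a) 0).
Proof.
move=> x0 uv; have [ut|tu] := leP u t.
  have z s : Num.max (Num.min s u - t) 0 = 0.
    by apply/max_idPr; rewrite subr_le0 ge_min ut orbT.
  rewrite !z subrr add0r le_min ge_min lexx /= ge_min; apply/orP; right.
  by rewrite ge_max !le_max lerD2r le_max !lexx !orbT.
apply: (@le_trans _ _ (Num.min x (Num.max (u - a) 0))); last first.
  rewrite le_min ge_min lexx /= ge_min; apply/orP; right.
  by rewrite ge_max !le_max lerD2r le_max uv !lexx !orbT.
have [|au] := leP u a => [ua|].
  rewrite (min_idPr (_ : u <= a + x)); last lra.
  rewrite subrr add0r le_min ge_min lexx /=.
  by rewrite ge_min; apply/orP; right; rewrite ge_max !le_max lexx orbT andbT; lra.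
rewrite (max_idPl (_ : 0 <= u - a)); last lra.
have [at_|ta] := leP a t.
  rewrite (max_idPr (_ : a - t <= 0)) ?(max_idPl (_ : 0 <= t - a)); [|lra..].
  by rewrite !minEle !maxEle; repeat (case: ifPn; rewrite -?ltNge => ?); lra.
rewrite (max_idPl (_ : 0 <= a - t)) ?(max_idPr (_ : t - a <= 0)); [|lra..].
by rewrite !minEle !maxEle; repeat (case: ifPn; rewrite -?ltNge => ?); lra.
Qed.

Section Windows.
Variables (n K : nat) (R : realDomainType) (g : medge n -> R).
Hypothesis g_gt0 : forall e, valid_edge e -> 0 < g e.
Variables (i j : 'I_n).
Hypothesis ij : (i < j)%N.

Definition arrival_cost (e : medge n) : R := \sum_(l < e.2.+1) g (e.1, l : nat).

Notation cK := (fun e : kedge n K => arrival_cost (kemb e)).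
Notation full := (kfull n K).

(** The m-th gap of the pair enters the costs of its points m, m+1, ... only. Without these points,
    [tau] no longer involves that gap. *)
Definition kcut m : {set kedge n K} :=
  [set e in full | ~~ ((e.1 == (i, j)) && (m <= e.2)%N)].

Lemma kcut_sub m : {subset kcut m <= full}.
Proof. by move=> e; rewrite inE => /andP[]. Qed.

Lemma arrival_costS m : arrival_cost (i, j, m.+1) = arrival_cost (i, j, m) + g (i, j, m.+1).
Proof. by rewrite /arrival_cost big_ord_recr. Qed.

Lemma arrival_cost_lt m m' : (m < m')%N -> arrival_cost (i, j, m) < arrival_cost (i, j, m').
Proof.
elim: m' => // m' IH; rewrite ltnS leq_eqVlt arrival_costS => /predU1P[->|/IH h].
  by rewrite ltrDl g_gt0.
by apply: lt_trans h _; rewrite ltrDl g_gt0.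
Qed.

Lemma below_kcut e : e \in full -> e.1 = (i, j) ->
  {subset [set f in full | cK f < cK e] <= kcut e.2}.
Proof.
case: e => [p0 m] eF /= ep [p l]; rewrite {}ep in eF *; rewrite !inE => /andP[-> /= h].
apply/negP => /andP[/eqP pE ml]; move: h; rewrite pE /kemb /= => h.
by move: ml; rewrite leq_eqVlt => /predU1P[E|/arrival_cost_lt/lt_trans/(_ h)];
  [rewrite E ltxx in h|rewrite ltxx].
Qed.

(* If e survives in the K-th left-over, its ends were already joined in the
   previous one by cheaper edges, none of which is parallel and later than e. *)
Lemma window_not_lev M e : (0 < K)%N -> e \in full -> e.1 = (i, j) ->
  cK e <= tau (@kemb n K) cK M K.-1 (kcut e.2) i j ->
  e \notin lev (@kemb n K) cK K full.
Proof.
move=> K0 eF e1; apply: contraTN => el; rewrite -ltNge.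
apply: tau_lt; first by rewrite -val_eqE /= neq_ltn ij.
move: el; rewrite -[X in olev _ _ X]prednK // olevS in_left => /andP[_].
rewrite /= e1 /=; apply: econn_sub => f; rewrite -lev_below inE => fl.
have fl' := fl; have /andP[_ ->] : (f \in full) && (cK f < cK e).
  by move: (olev_sub fl); rewrite inE.
by rewrite andbT; apply: olev_mono fl; exact: below_kcut.
Qed.

(** In round q, the surviving edge numbered q joins the ends of every later parallel edge. *)
Lemma parallel_lev q (m : 'I_K) : (q <= m)%N ->
  (i, j, m) \in lev (@kemb n K) cK q full.
Proof.
elim: q m => [|q IH] m qm; first by rewrite inE.
rewrite olevS in_left IH ?(ltnW qm) //=.
have qK : (q < K)%N by apply: ltn_trans qm _.
apply: (@conn_ends _ _ (i, j, q)); apply/fintype.imageP.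
by exists (i, j, Ordinal qK) => //; rewrite inE IH //=; exact: arrival_cost_lt.
Qed.

(** The last of the K kept parallel edges is still present at level [K.-1], so K gaps reach past
    [tau] whatever the cap. *)
Lemma tau_le_arrival_cost M : (0 < K)%N ->
  tau (@kemb n K) cK M K.-1 full i j <= arrival_cost (i, j, K.-1).
Proof.
move=> K0; have jK : (K.-1 < K)%N by rewrite prednK.
apply: (@tau_le _ _ _ _ _ _ _ _ _ _ (i, j, Ordinal jK)); first by rewrite inE.
apply: (@conn_ends _ _ (i, j, K.-1)); apply/fintype.imageP.
by exists (i, j, Ordinal jK) => //; rewrite inE parallel_lev /=.
Qed.

(** Start of the m-th gap: zero for [m = 0], otherwise the cost of the point numbered [m.-1]. *)
Definition arrival m : R := \sum_(l < m) g (i, j, l : nat).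

Definition window (s : R) m : R := Num.max (s - arrival m) 0.

(* Cut [t, max tau t] at the successive points of the pair (i, j): before the
   m-th of them, tau is at most its value with the points m, m+1, ... removed. *)
Lemma excess_le_windows M t : (0 < K)%N -> 0 <= t ->
  Num.max (tau (@kemb n K) cK M K.-1 full i j - t) 0 +
    \sum_(m < K) Num.min (g (i, j, m : nat)) (window t m) <=
  \sum_(m < K) Num.min (g (i, j, m : nat))
    (window (Num.max (tau (@kemb n K) cK M K.-1 (kcut m) i j) t) m).
Proof.
move=> K0 t0; set u := tau _ _ _ _ full _ _.
pose h s := Num.max (Num.min s u - t) 0.
have -> : Num.max (u - t) 0 = \sum_(m < K) (h (arrival m.+1) - h (arrival m)).
  rewrite -(big_mkord xpredT (fun m => h (arrival m.+1) - h (arrival m))) telescope_sumr //.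
  have -> : h (arrival 0) = 0.
    by rewrite /h /arrival big_ord0; apply/max_idPr; rewrite subr_le0 ge_min t0.
  rewrite subr0 /h (min_idPr _) //.
  by rewrite -(prednK K0); exact: tau_le_arrival_cost.
rewrite -big_split; apply: ler_sum => m _ /=.
set v := tau _ _ _ _ _ _ _.
have uv : u <= v by apply: tau_sub; exact: kcut_sub.
have gm : 0 < g (i, j, m : nat) by exact: g_gt0.
have -> : arrival m.+1 = arrival m + g (i, j, m : nat) by rewrite /arrival big_ord_recr.
exact: clamp_step.
Qed.

End Windows.

(** * An exponential variable against an independent threshold *)

Section IndependentExponential.
Local Open Scope ereal_scope.
Context d (T : measurableType d) (R : realType) (P : probability T R).
Variables (G Y : T -> R).
Hypothesis expG : exp1_rv P G.
Hypothesis mY : measurable_fun setT Y.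
Hypothesis indepGY : forall A B : set R, measurable A -> measurable B ->
  P (G @^-1` A `&` Y @^-1` B) = P (G @^-1` A) * P (Y @^-1` B).

Let mG : measurable_fun setT G. Proof. by case: expG. Qed.
Let Gm : {mfun T >-> R} := HB.pack G (isMeasurableFun.Build _ _ _ _ G mG).
Let Ym : {mfun T >-> R} := HB.pack Y (isMeasurableFun.Build _ _ _ _ Y mY).

Let measurable_le_fun (f g : T -> R) : measurable_fun setT f -> measurable_fun setT g ->
  measurable [set x | (f x <= g x)%R].
Proof. by move=> mf mg; rewrite -[X in measurable X]setTI; exact: measurable_fun_le. Qed.

Let measurable_lt_fun (f g : T -> R) : measurable_fun setT f -> measurable_fun setT g ->
  measurable [set x | (f x < g x)%R].
Proof.
move=> mf mg; rewrite (_ : [set _ | _] = ~` [set x | (g x <= f x)%R]).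
  by apply: measurableC; exact: measurable_le_fun.
by apply/seteqP; split => x /=; rewrite ltNge => /negP.
Qed.

Lemma exp1_cdf y : (0 <= y)%R -> P [set x | (G x <= y)%R] = (1 - expR (- y))%:E.
Proof.
move=> y0; rewrite (_ : [set _ | _] = ~` [set x | (y < G x)%R]); last first.
  by apply/seteqP; split => x /=; rewrite leNgt => /negP.
rewrite probability_setC; last exact: measurable_lt_fun.
by rewrite expG.2 // EFinB.
Qed.

Lemma exp1_le0 : P [set x | (G x <= 0)%R] = 0.
Proof. by rewrite exp1_cdf // oppr0 expR0 subrr. Qed.

Lemma exp1_atom y : P [set x | G x = y] = 0.
Proof.
have mE : measurable [set x | G x = y].
  by have := mG measurableT (measurable_set1 y); rewrite setTI.
apply/eqP; rewrite eq_le measure_ge0 andbT; have [y0|y0] := leP y 0%R.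
  rewrite -exp1_le0; apply: le_measure; rewrite ?inE //; first exact: measurable_le_fun.
  by move=> x /= ->.
apply/lee_addgt0Pr => e e0; rewrite add0e.
(* The tail difference over an interval of length [h] ending at [y] is [expR (- y) * (expR h - 1)],
   and [h] is chosen to make it at most [e]. The minimum with [y] keeps [y - h] nonnegative, where
   the tail formula holds. *)
pose h := Num.min y (ln (1 + e * expR y)).
have ee : (0 < e * expR y)%R by rewrite mulr_gt0 ?expR_gt0.
have h0 : (0 < h)%R by rewrite lt_min y0 ln_gt0 //; lra.
have hy : (h <= y)%R by rewrite ge_min lexx.
have he : (expR h <= 1 + e * expR y)%R.
  rewrite -[leRHS]lnK ?posrE; last by lra.
  by rewrite ler_expR ge_min lexx orbT.
apply: (@le_trans _ _ (P ([set x | (y - h < G x)%R] `\` [set x | (y < G x)%R]))).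
  apply: le_measure; rewrite ?inE //; first by apply: measurableD; exact: measurable_lt_fun.
  by move=> x /= ->; split; [lra|rewrite ltxx].
rewrite measureD; [|exact: measurable_lt_fun..|]; last first.
  by rewrite ltey_eq fin_num_measure //; exact: measurable_lt_fun.
rewrite setIidr; last by move=> x /=; lra.
apply: (@le_trans _ _ ((expR (- (y - h)))%:E - (expR (- y))%:E)).
  by rewrite -(expG.2 (y - h)%R) -?(expG.2 y); [exact: lexx|lra..].
rewrite -EFinB lee_fin opprB addrC expRD.
have : (expR (- y) * expR h <= expR (- y) + e)%R.
  apply: le_trans (ler_wpM2l (expR_ge0 _) he) _.
  by rewrite mulrDr mulr1 mulrCA -expRD addNr expR0 mulr1.
rewrite mulrC; lra.
Qed.

(** By independence the law of the pair agrees with the product law on rectangles, hence everywhere;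
    its mass is then computed by sections. *)
Let law_xsection (D : set (R * R)) : measurable D ->
  P ((fun x => (Y x, G x)) @^-1` D) = \int[P]_x P (G @^-1` xsection D (Y x)).
Proof.
move=> mD.
have mYG : measurable_fun setT (fun x => (Y x, G x)) by exact: measurable_fun_pair.
pose YGm : {mfun T >-> (R * R)%type} :=
  HB.pack (fun x => (Y x, G x)) (isMeasurableFun.Build _ _ _ _ _ mYG).
have /= h := @product_measure_unique _ _ _ _ _ (distribution P Ym) (distribution P Gm)
  (distribution P YGm) _ D mD.
transitivity ((distribution P Ym \x distribution P Gm) D).
  by rewrite h // => A B mA mB; rewrite muleC -indepGY // setIC.
apply: (@ge0_integral_distribution _ _ _ _ _ P Ym
  (fun y => distribution P Gm (xsection D y))) => [|y]; last exact: measure_ge0.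
exact: (@measurable_fun_xsection _ _ _ _ _ (distribution P Gm)).
Qed.

Lemma indep_exp1_neq : P [set x | G x = Y x] = 0.
Proof.
have mD : measurable [set p : R * R | p.2 = p.1].
  rewrite (_ : [set _ | _] = [set p : R * R | (p.2 <= p.1)%R] `&` [set p | (p.1 <= p.2)%R]).
    by apply: measurableI; rewrite -[X in measurable X]setTI; apply: measurable_fun_le.
  apply/seteqP; split => p /=; first by move=> ->.
  by move=> [? ?]; apply: le_anti; apply/andP.
rewrite (law_xsection mD) integral0_eq // => x _.
rewrite (_ : _ @^-1` _ = [set z | G z = Y x]); first exact: exp1_atom.
by apply/seteqP; split => z; rewrite /xsection /= inE.
Qed.

Hypothesis Y0 : forall x, (0 <= Y x)%R.

Let le_expR_min : P [set x | (G x <= Y x)%R] = \int[P]_x (1 - expR (- Y x))%:E.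
Proof.
have mD : measurable [set p : R * R | (p.2 <= p.1)%R].
  by rewrite -[X in measurable X]setTI; apply: measurable_fun_le.
rewrite (law_xsection mD); apply: eq_integral => x _.
rewrite (_ : _ @^-1` _ = [set z | (G z <= Y x)%R]); first exact: exp1_cdf.
by apply/seteqP; split => z; rewrite /xsection /= inE.
Qed.

Let pdf : R -> R := exponential_pdf 1.

Let pdfE t : (0 <= t)%R -> pdf t = expR (- t).
Proof. by move=> t0; rewrite /pdf exponential_pdfE // mul1r mulN1r. Qed.

Let pdf_lt0 t : (t < 0)%R -> pdf t = 0%R.
Proof. exact: lt0_exponential_pdf. Qed.

Let pdf_ge0 t : (0 <= pdf t)%R. Proof. exact: exponential_pdf_ge0. Qed.

Let kernel (p : T * R) : \bar R := (if (p.2 < Y p.1)%R then pdf p.2 else 0%R)%:E.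

Let measurable_kernel : measurable_fun setT kernel.
Proof.
apply/measurable_EFinP; apply: measurable_fun_ifT => //.
  apply: measurable_fun_ltr => //.
  exact: measurableT_comp.
by apply: measurableT_comp => //; exact: measurable_exponential_pdf.
Qed.

Let kernel_ge0 p : 0 <= kernel p.
Proof. by rewrite lee_fin; case: ifP. Qed.

Let int_kernel x : \int[lebesgue_measure]_t kernel (x, t) = (1 - expR (- Y x))%:E.
Proof.
transitivity (\int[lebesgue_measure]_(t in `[0%R, Y x[) (pdf t)%:E).
  rewrite [RHS]integral_mkcond; apply: eq_integral => t _.
  rewrite /kernel /= patchE; have [/andP[t0 tY]|h] := boolP ((0 <= t) && (t < Y x))%R.
    by rewrite mem_set ?tY //= in_itv /= t0 tY.
  rewrite memNset /= ?in_itv /=; last exact/negP.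
  by case: ifP => // tY; rewrite pdf_lt0 //; move: h; rewrite tY andbT ltNge.
have [Yx|Yx] := leP (Y x) 0%R.
  have -> : Y x = 0%R by apply: le_anti; rewrite Yx Y0.
  by rewrite set_itvco0 integral_set0 oppr0 expR0 subrr.
rewrite integral_itv_bndo_bndc; last first.
  by apply/measurable_EFinP/measurable_funTS; exact: measurable_exponential_pdf.
by have := exponential_prob_itv0c 1 Yx; rewrite /exponential_prob mulN1r EFinB => <-.
Qed.

Let int_kernel2 t : \int[P]_x kernel (x, t) = (pdf t)%:E * P [set x | (t < Y x)%R].
Proof.
have mt : measurable [set x | (t < Y x)%R] by exact: measurable_lt_fun.
transitivity (\int[P]_x ((pdf t)%:E * (\1_[set x | (t < Y x)%R] x)%:E)).
  apply: eq_integral => x _; rewrite /kernel indicE /=.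
  have [h|h] := ltP t (Y x); first by rewrite mem_set ?mule1.
  by rewrite memNset ?mule0 //=; apply/negP; rewrite -leNgt.
by rewrite ge0_integralZl_EFin // ?integral_indic ?setIT //; exact/measurable_EFinP.
Qed.

(** Tonelli applied to [kernel]. Integrating in t first gives the probability that [G] falls below
    the value of [Y]; integrating over outcomes first gives [expR (- t)] times the tail of [Y],
    which is the tail of the minimum. The maximum with 0 is there because [G] is positive only
    almost surely. *)
Lemma indep_exp1_min : \int[P]_x (Num.max (Num.min (G x) (Y x)) 0)%:E =
  P [set x | (G x <= Y x)%R].
Proof.
have mX : measurable_fun setT (fun x => Num.max (Num.min (G x) (Y x)) 0%R).
  by apply: measurable_maxr => //; exact: measurable_minr.
pose Xm : {mfun T >-> R} := 
  HB.pack (fun x => Num.max (Num.min (G x) (Y x)) 0%R) (isMeasurableFun.Build _ _ _ _ _ mX).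
have := ge0_expectation_ccdf (P := P) (X := Xm); rewrite unlock => -> /=; last first.
  by move=> x; rewrite le_max lexx orbT.
rewrite le_expR_min; under [RHS]eq_integral do rewrite -int_kernel.
rewrite (fubini_tonelli (m1 := P) (m2 := lebesgue_measure) kernel) //.
rewrite integral_mkcond; apply: eq_integral => t _.
rewrite int_kernel2 patchE; have [t0|t0] := boolP (0 <= t)%R; last first.
  rewrite memNset /= ?in_itv /= ?andbT; last exact/negP.
  by rewrite pdf_lt0 ?mul0e // ltNge.
rewrite mem_set /= ?in_itv /= ?t0 // pdfE // -expG.2 //.
have := @indepGY `]t, +oo[%classic `]t, +oo[%classic (measurable_itv _) (measurable_itv _).
have fE (f : T -> R) : f @^-1` `]t, +oo[%classic = [set x | (t < f x)%R].
  by apply/seteqP; split => z; rewrite /= in_itv /= andbT.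
rewrite !fE => <-; rewrite /ccdf /distribution /pushforward; congr (P _).
apply/seteqP; split => z; rewrite /= in_itv /= andbT lt_max lt_min (ltNge t 0%R) t0 orbF.
  by move/andP.
by case=> -> ->.
Qed.

End IndependentExponential.

(** * Independence of one coordinate from finitely many others *)

Section Independence.
Local Open Scope ereal_scope.
Context d (T : measurableType d) (R : realType) (P : probability T R).
Variables (I : eqType) (J : set I) (X : I -> T -> R).
Hypothesis indep : mutually_independent P J X.
Hypothesis mX : forall i, J i -> measurable_fun setT (X i).
Variables (e : I) (F : seq I).
Hypotheses (Je : J e) (uF : uniq F) (FJ : [set` F] `<=` J) (eF : e \notin F).

Definition rectangles : set (set T) :=
  [set A | exists2 B : I -> set R, (forall i, measurable (B i)) &
           A = \bigcap_(i in [set` F]) (X i @^-1` B i)].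

Let mXB i (B : set R) : J i -> measurable B -> measurable (X i @^-1` B).
Proof. by move=> Ji mB; rewrite -[X in measurable X]setTI; exact: mX. Qed.

Lemma measurable_rectangles : rectangles `<=` @measurable _ T.
Proof.
move=> _ [B mB ->]; apply: fin_bigcap_measurable => [|i /= iF]; first exact: finite_seq.
by apply: mXB; [exact: FJ|exact: mB].
Qed.

Lemma indep_rectangle A Z : measurable A -> rectangles Z ->
  P (X e @^-1` A `&` Z) = P (X e @^-1` A) * P Z.
Proof.
move=> mA [B mB ->].
pose B' i := if i == e then A else B i.
have mB' i : measurable (B' i) by rewrite /B'; case: ifP.
have B'F i : i \in F -> B' i = B i.
  by rewrite /B' => iF; case: eqP => // ie; move: eF; rewrite -ie iF.
have capF : \bigcap_(i in [set` F]) (X i @^-1` B' i) = \bigcap_(i in [set` F]) (X i @^-1` B i).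
  by apply: eq_bigcapr => i /B'F ->.
have := indep (F := e :: F) (B := B') _ _ mB'; rewrite /= eF uF => /(_ isT).
have sub : [set` e :: F] `<=` J.
  by move=> i /=; rewrite inE => /orP[/eqP ->|/FJ].
move=> /(_ sub); rewrite big_cons.
have <- : P (\bigcap_(i in [set` F]) (X i @^-1` B' i)) = \prod_(i <- F) P (X i @^-1` B' i).
  exact: indep.
rewrite capF (_ : [set` e :: F] = e |` [set` F]); last first.
  by apply/seteqP; split => i /=; rewrite inE => /predU1P.
by rewrite bigcap_setU1 capF /B' eqxx.
Qed.

(** For fixed [A] both sides are finite measures in [Z] that agree on [rectangles], a generating
    family closed under intersection. *)
Lemma indep_generated A Z : measurable A -> <<s rectangles>> Z ->
  P (X e @^-1` A `&` Z) = P (X e @^-1` A) * P Z.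
Proof.
move=> mA sZ.
have mXA : measurable (X e @^-1` A) by exact: mXB.
pose m1 := mrestr P mXA.
pose c : {nonneg R} := NngNum (fine_ge0 (measure_ge0 P (X e @^-1` A))).
have : m1 Z = mscale c P Z.
  apply: (@g_sigma_algebra_measure_unique _ _ _ rectangles measurable_rectangles (fun=> setT)) => //.
  - move=> _; exists (fun=> setT) => //.
    by apply/seteqP; split.
  - by rewrite bigcup_const.
  - move=> _ _ [B mB ->] [B' mB' ->]; exists (fun i => B i `&` B' i).
      by move=> i; exact: measurableI.
    by rewrite -bigcapI.
  - move=> Z' rZ'; change (P (Z' `&` X e @^-1` A) = (fine (P (X e @^-1` A)))%:E * P Z').
    by rewrite setIC indep_rectangle // fineK // fin_num_measure.
  - move=> _; change (P (setT `&` X e @^-1` A) < +oo).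
    by rewrite setTI ltey_eq fin_num_measure.
rewrite /m1 /mrestr /mscale /= setIC => ->.
by rewrite fineK // fin_num_measure.
Qed.

(** Measurability from this space expresses dependence on the coordinates in [F] alone. *)
Let TF := g_sigma_algebraType rectangles.

Lemma measurable_coord i : i \in F -> measurable_fun setT (X i : TF -> R).
Proof.
move=> iF _ B mB; rewrite setTI; apply: sub_sigma_algebra.
exists (fun j => if j == i then B else setT); first by move=> j; case: ifP.
apply/seteqP; split => [x Bx j jF /=|x /(_ i iF)]; first by case: eqP => [->|].
by rewrite /= eqxx.
Qed.

Lemma indep_coord (Y : TF -> R) A B : measurable_fun setT Y -> measurable A -> measurable B ->
  P (X e @^-1` A `&` Y @^-1` B) = P (X e @^-1` A) * P (Y @^-1` B).
Proof.
by move=> mY mA mB; apply: indep_generated => //; rewrite -[X in _ X]setTI; exact: mY.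
Qed.

End Independence.

(** * Measurability of quantities driven by the cost order *)

Section FiniteMeasurability.
Context d (T : measurableType d) (R : realType).

Lemma measurable_finset_pred (U : finType) (h : T -> {set U}) (Q : pred {set U}) :
  (forall u, measurable [set x | u \in h x]) -> measurable [set x | Q (h x)].
Proof.
move=> mh; rewrite (_ : [set _ | _] = \bigcup_(A in [set A | Q A]) [set x | h x = A]).
  apply: fin_bigcup_measurable => [|A _]; first exact: finite_finset.
  rewrite (_ : [set _ | _] = \bigcap_(u in [set: U]) [set x | (u \in h x) = (u \in A)]).
    apply: fin_bigcap_measurable => [|u _]; first exact: finite_finset.
    case: (u \in A); first exact: mh.
    rewrite (_ : [set _ | _] = ~` [set x | u \in h x]); first exact: measurableC.
    by apply/seteqP; split => x /=; [move=> ->|move/negP/negbTE].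
  apply/seteqP; split => [x /= xA u _ /=|x /= hA]; first by rewrite xA.
  by apply/setP => u; apply: hA.
by apply/seteqP; split => x /= => [Qx|[A QA ->]] //; exists (h x).
Qed.

Lemma measurable_bigmin (I : Type) (s : seq I) (M : R) (f : I -> T -> R) :
  (forall i, measurable_fun setT (f i)) ->
  measurable_fun setT (fun x => \big[Num.min/M]_(i <- s) f i x).
Proof.
move=> mf; elim: s => [|i s IH].
  by apply: (eq_measurable_fun (fun=> M)) => [x _|//]; rewrite big_nil.
apply: (eq_measurable_fun (fun x => Num.min (f i x) (\big[Num.min/M]_(i <- s) f i x))).
  by move=> x _; rewrite big_cons.
exact: measurable_minr.
Qed.

Lemma measurable_sumr (I : finType) (f : I -> T -> R) :
  (forall i, measurable_fun setT (f i)) ->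
  measurable_fun setT (fun x => \sum_i f i x).
Proof. by move=> mf; apply: measurable_sum => i; exact: mf. Qed.

Section Costs.
Variables (n : nat) (E : finType) (emb : E -> medge n) (c : T -> E -> R).
Hypothesis mc : forall e, measurable_fun setT (fun x => c x e).

Lemma measurable_order_pred (Q : pred {set E * E}) :
  measurable [set x | Q (cost_order (c x))].
Proof.
apply: measurable_finset_pred => -[e f].
rewrite (_ : [set _ | _] = [set x | c x e < c x f]); last first.
  by apply/seteqP; split => x; rewrite /= inE.
have := @measurable_fun_ltr _ _ R setT _ _ (mc e) (mc f) measurableT [set true] I.
by rewrite setTI.
Qed.

(** Which edges compete in the minimum is a predicate of the cost order, which takes finitely many
    values. *)
Lemma measurable_tau M j (S : {set E}) u v :
  measurable_fun setT (fun x => tau emb (c x) M j S u v).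
Proof.
rewrite /tau /otau; under eq_fun do rewrite bigmin_mkcond.
apply: measurable_bigmin => f; apply: measurable_fun_ifT => //.
apply: (@measurable_fun_bool _ _ _ _ true); rewrite setTI.
exact: (measurable_order_pred (fun o =>
  (f \in S) && econn emb [set g in olev emb o j S | (f, g) \notin o] u v)).
Qed.

End Costs.
End FiniteMeasurability.

Section Model.
Variables (n K : nat) (R : realType).

Notation full := (kfull n K).
Notation cK g := (fun e : kedge n K => arrival_cost g (kemb e)).

Lemma measurable_arrival_cost d (T : measurableType d) (g : T -> medge n -> R)
    (p : 'I_n * 'I_n) m :
  (forall l, (l <= m)%N -> measurable_fun setT (fun x => g x (p, l))) ->
  measurable_fun setT (fun x => arrival_cost (g x) (p, m)).
Proof. by move=> mg; apply: measurable_sumr => l; apply: mg; rewrite -ltnS. Qed.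

Variables (i j : 'I_n).
Hypothesis ij : (i < j)%N.

Definition other_gaps (e : medge n) : seq (medge n) :=
  [seq f <- [seq kemb f | f <- enum full] | f != e].

Lemma other_gapsP (e : medge n) (p : 'I_n * 'I_n) l : (l < K)%N -> (p.1 < p.2)%N -> (p, l) != e ->
  (p, l) \in other_gaps e.
Proof.
move=> lK pv pe; rewrite mem_filter pe /=; apply/mapP; exists (p, Ordinal lK).
  by rewrite mem_enum inE.
by case: p pv pe.
Qed.

Lemma measurable_cut_window d (T : measurableType d) (g : T -> medge n -> R) M t (m : 'I_K) :
  (forall e, e \in other_gaps (i, j, m : nat) -> measurable_fun setT (fun x => g x e)) ->
  measurable_fun setT (fun x => window (g x) i j
    (Num.max (tau (@kemb n K) (cK (g x)) M K.-1 (kcut K i j m) i j) t) m).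
Proof.
move=> mg; apply: measurable_maxr => //; apply: measurable_funB; last first.
  apply: measurable_sumr => l; apply: mg; apply: other_gapsP => //.
    by apply: ltn_trans (ltn_ord m).
  by apply/eqP => -[lm]; have := ltn_ord l; rewrite lm ltnn.
apply: measurable_maxr => //.
(* Costs of deleted edges may involve the excluded gap; zeroing them leaves [tau] on [kcut]
   unchanged. *)
pose c x (f : kedge n K) := if f \in kcut K i j m then cK (g x) f else 0.
apply: (eq_measurable_fun (fun x => tau (@kemb n K) (c x) M K.-1 (kcut K i j m) i j)).
  by move=> x _; apply: tau_ext => f fS; rewrite /c fS.
apply: measurable_tau => f; rewrite /c; case fS: (f \in kcut K i j m) => //.
apply: measurable_arrival_cost => l lf.
have fF : f \in full by apply: kcut_sub fS.
apply: mg; apply: other_gapsP.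
- by apply: leq_ltn_trans lf (ltn_ord _).
- by rewrite inE in fF.
- move: fS; rewrite inE => /andP[_]; apply: contraNneq => -[h1 h2 h3].
  by rewrite -h3 lf andbT; case: f h1 h2 {lf fF} => [[a b] q] /= -> ->.
Qed.

Lemma measurable_window d (T : measurableType d) (g : T -> medge n -> R) t (m : 'I_K) :
  (forall e, e \in other_gaps (i, j, m : nat) -> measurable_fun setT (fun x => g x e)) ->
  measurable_fun setT (fun x => window (g x) i j t m).
Proof.
move=> mg; apply: measurable_maxr => //; apply: measurable_funB => //.
apply: measurable_sumr => l; apply: mg; apply: other_gapsP => //.
  by apply: ltn_trans (ltn_ord m).
by apply/eqP => -[lm]; have := ltn_ord l; rewrite lm ltnn.
Qed.

End Model.

(** * Gaps and costs in the Poisson model *)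

Section PoissonModel.
Local Open Scope ereal_scope.
Context d (T : measurableType d) (R : realType) (P : probability T R).
Variables (n K : nat) (G : 'I_n -> 'I_n -> nat -> T -> R).
Hypothesis model : poisson_multigraph P G.

Notation full := (kfull n K).

Definition gaps (x : T) (e : medge n) : R := G e.1.1 e.1.2 e.2 x.

Notation cK x := (fun e : kedge n K => arrival_cost (gaps x) (kemb e)).
Notation tauK x M i j := (tau (@kemb n K) (cK x) M K.-1 full i j).
Notation levK x := (lev (@kemb n K) (cK x) K full).

Lemma gaps_exp (e : medge n) : valid_edge e -> exp1_rv P (fun x => gaps x e).
Proof. by move=> ve; exact: (model.2 e.1.1 e.1.2 e.2 ve). Qed.

Lemma measurable_gaps (e : medge n) : valid_edge e -> measurable_fun setT (fun x => gaps x e).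
Proof. by move/gaps_exp => -[]. Qed.

Lemma measurable_kcost (e : kedge n K) : e \in full ->
  measurable_fun setT (fun x => cK x e).
Proof.
rewrite inE => ve; case: e ve => -[i j] m /= ve.
by apply: measurable_arrival_cost => l _; exact: measurable_gaps.
Qed.

Lemma other_gaps_valid (e f : medge n) : f \in other_gaps K e -> valid_edge f.
Proof.
by rewrite mem_filter => /andP[_ /mapP[g]]; rewrite mem_enum inE => vg ->.
Qed.

(* Asking for measurability over every T' in which the other gaps are measurable
   makes Y measurable for the sigma-algebra that they generate. *)
Lemma gap_indep (e : medge n) (Y : (medge n -> R) -> R) : valid_edge e ->
  (forall d' (T' : measurableType d') (g : T' -> medge n -> R),
    (forall f, f \in other_gaps K e -> measurable_fun setT (fun x => g x f)) ->
    measurable_fun setT (fun x => Y (g x))) ->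
  forall A B : set R, measurable A -> measurable B ->
  P ((fun x => gaps x e) @^-1` A `&` (fun x => Y (gaps x)) @^-1` B) =
  P ((fun x => gaps x e) @^-1` A) * P ((fun x => Y (gaps x)) @^-1` B).
Proof.
move=> ve mY A B mA mB.
pose X (f : medge n) x := gaps x f.
have uF : uniq (other_gaps K e).
  by rewrite filter_uniq // (map_inj_uniq (@kemb_inj n K)) enum_uniq.
have FJ : [set` other_gaps K e] `<=` (@valid_edge n) by move=> f /other_gaps_valid.
have eF : e \notin other_gaps K e by rewrite mem_filter eqxx.
apply: (@indep_coord _ T R P _ (@valid_edge n) X model.1 _ e (other_gaps K e)) => //.
  by move=> f; exact: measurable_gaps.
by apply: mY => f fF; exact: measurable_coord.
Qed.

Lemma gaps_gt0_ae : {ae P, forall x, forall e, valid_edge e -> (0 < gaps x e)%R}.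
Proof.
have h (m : nat) : {ae P, forall x, forall i j : 'I_n, (i < j)%N -> (0 < G i j m x)%R}.
  apply: filter_forall => i; apply: filter_forall => j.
  have [ij|ij] := boolP (i < j)%N; last exact: aeW.
  exists [set x | (G i j m x <= 0)%R]; split.
  - have := @measurable_fun_ler _ _ R setT _ _ (model.2 i j m ij).1
      (@measurable_cst _ _ _ _ setT (0%R : R)) measurableT [set true] I.
    by rewrite setTI.
  - exact: (exp1_le0 (model.2 i j m ij)).
  - by move=> x /= /not_implyP[_ /negP]; rewrite -leNgt.
apply: filterS (ae_foralln h) => x hx [[i j] m] ve; exact: hx.
Qed.

Lemma ae_ge_measure (A B : set T) : measurable A -> measurable B ->
  {ae P, forall x, A x -> B x} -> P A <= P B.
Proof.
move=> mA mB AB; rewrite -[A]setIT -[B]setIT -!integral_indic //.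
have m1 (C : set T) : measurable C -> measurable_fun setT (fun x => (\1_C x)%:E : \bar R).
  by move=> mC; exact/measurable_EFinP.
apply: ae_ge0_le_integral; rewrite ?m1 //; try by move=> x _; rewrite lee_fin.
- exact: m1.
- exact: m1.
- apply: filterS AB => x AB _; rewrite lee_fin !indicE ler_nat.
  by have [/set_mem/AB/mem_set ->|//] := boolP (x \in A).
Qed.

(** Equality of the two costs means that the last gap of [e] equals [Y], the cost of [f] minus the
    earlier gaps of [e]. As [f] belongs to another pair, [Y] is independent of that gap, which has
    no atoms. *)
Lemma kcost_neq_ae (e f : kedge n K) : e \in full -> f \in full -> e.1 != f.1 ->
  {ae P, forall x, cK x e <> cK x f}.
Proof.
move=> eF fF ef.
pose Y (g : medge n -> R) := (arrival_cost g (kemb f) - \sum_(l < e.2) g (e.1, l : nat))%R.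
have ve : valid_edge (kemb e) by rewrite inE in eF.
have mY d' (T' : measurableType d') (g : T' -> medge n -> R) :
    (forall h, h \in other_gaps K (kemb e) -> measurable_fun setT (fun x => g x h)) ->
    measurable_fun setT (fun x => Y (g x)).
  move=> mg; apply: measurable_funB.
    apply: measurable_arrival_cost => l lf; apply: mg; apply: other_gapsP.
    - exact: leq_ltn_trans lf (ltn_ord _).
    - by rewrite inE in fF.
    - apply: contraNneq ef => -[h1 h2 _]; apply/eqP.
      by rewrite [e.1]surjective_pairing [f.1]surjective_pairing h1 h2.
  apply: measurable_sumr => l; apply: mg; apply: other_gapsP => //.
    exact: ltn_trans (ltn_ord l) (ltn_ord _).
  by apply/eqP => /(congr1 snd) /= lm; have := ltn_ord l; rewrite lm ltnn.
have mg : measurable_fun setT (fun x => Y (gaps x)).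
  by apply: mY => h /other_gaps_valid; exact: measurable_gaps.
exists [set x | gaps x (kemb e) = Y (gaps x)]; split.
- rewrite (_ : [set _ | _] = [set x | (gaps x (kemb e) - Y (gaps x))%R = 0%R]); last first.
    by apply/seteqP; split => x /= h; [rewrite h subrr|apply/eqP; rewrite -subr_eq0 h].
  have := measurable_funB (measurable_gaps ve) mg measurableT (measurable_set1 0%R).
  by rewrite setTI.
- by apply: (indep_exp1_neq (gaps_exp ve) mg); exact: gap_indep.
- move=> x /= /contrapT; rewrite /Y /arrival_cost => <-.
  by rewrite big_ord_recr /= [X in (X - _)%R]addrC addrK.
Qed.

Lemma kcost_inj_ae : {ae P, forall x, {in full &, injective (cK x)}}.
Proof.
have h : {ae P, forall x, forall e f : kedge n K,
    e \in full -> f \in full -> e.1 != f.1 -> cK x e <> cK x f}.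
  apply: filter_forall => e; apply: filter_forall => f.
  have [eF|eF] := boolP (e \in full); last exact: aeW.
  have [fF|fF] := boolP (f \in full); last exact: aeW.
  have [ef|ef] := boolP (e.1 != f.1); last exact: aeW.
  by apply: filterS (kcost_neq_ae eF fF ef).
apply: filterS2 h gaps_gt0_ae => x h g0 e f eF fF cef.
have [ef|/h] := eqVneq e.1 f.1; last by move=> /(_ eF fF).
case: e f eF fF cef ef => [[i j] m] [[i' j'] m'] eF _ cef [? ?]; subst i' j'.
have ij : (i < j)%N by rewrite inE in eF.
have gt : forall a b : nat, (a < b)%N -> (arrival_cost (gaps x) (i, j, a) < arrival_cost (gaps x) (i, j, b))%R.
  by move=> a b; exact: arrival_cost_lt.
suff -> : m = m' by [].
have cE : arrival_cost (gaps x) (i, j, m : nat) = arrival_cost (gaps x) (i, j, m' : nat) by exact: cef.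
have [/gt|/gt|/ord_inj //] := ltngtP (m : nat) m'; by rewrite cE ltxx.
Qed.

End PoissonModel.

(** * Mean excess of the joining cost *)

Section MeanExcess.
Local Open Scope ereal_scope.
Context d (T : measurableType d) (R : realType) (P : probability T R).
Variables (n K : nat) (G : 'I_n -> 'I_n -> nat -> T -> R).
Hypothesis model : poisson_multigraph P G.

Notation full := (kfull n K).
Notation cK x := (fun e : kedge n K => arrival_cost (gaps G x) (kemb e)).
Notation tauK x M i j := (tau (@kemb n K) (cK x) M K.-1 full i j).
Notation levK x := (lev (@kemb n K) (cK x) K full).

(** By [mem_lev_avail], not surviving K rounds means lying in one of the first K trees. *)
Definition late_edge t (e : kedge n K) : set T :=
  [set x | (e \notin levK x) && (t < cK x e)%R].

(** The model says nothing about gaps indexed by pairs with i >= j, so costs are zeroed there to be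
    measurable. *)
Let c0 x (f : kedge n K) : R := if f \in full then cK x f else 0%R.

Let mc0 f : measurable_fun setT (fun x => c0 x f).
Proof. by rewrite /c0; case fF: (f \in full) => //; exact: (measurable_kcost model). Qed.

Lemma measurable_tauK M i j : measurable_fun setT (fun x => tauK x M i j).
Proof.
apply: (eq_measurable_fun (fun x => tau (@kemb n K) (c0 x) M K.-1 full i j)).
  by move=> x _; apply: tau_ext => f fS; rewrite /c0 fS.
exact: measurable_tau.
Qed.

Lemma measurable_late_edge t e : e \in full -> measurable (late_edge t e).
Proof.
move=> eF; rewrite (_ : late_edge t e = [set x | e \notin levK x] `&` [set x | (t < cK x e)%R]).
  apply: measurableI; last first.
    have := @measurable_fun_ltr _ _ R setT _ _ (@measurable_cst _ _ _ _ setT t)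
      (measurable_kcost model eF) measurableT [set true] I.
    by rewrite setTI.
  rewrite (_ : [set _ | _] = [set x | e \notin lev (@kemb n K) (c0 x) K full]).
    exact: (measurable_order_pred mc0 (fun o => e \notin olev (@kemb n K) o K full)).
  apply/seteqP; split => x /=; rewrite (@lev_ext _ _ _ _ (cK x) (c0 x)) //;
    by move=> f fS; rewrite /c0 fS.
by apply/seteqP; split => x /= /andP.
Qed.

Let excess_ge0 (a b : R) : 0 <= (Num.max (a - b) 0)%:E.
Proof. by rewrite lee_fin le_max lexx orbT. Qed.

(** Integrate [excess_le_windows]: by [indep_exp1_min] each minimum of a gap and its window has as
    mean the probability that the gap ends inside the window. *)
Lemma mean_excess M t (i j : 'I_n) : (0 < K)%N -> (0 <= t)%R -> (i < j)%N ->
  \int[P]_x (Num.max (tauK x M i j - t) 0)%:E <= \sum_(m < K) P (late_edge t (i, j, m)).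
Proof.
move=> K0 t0 ij.
pose g (m : 'I_K) x := gaps G x (i, j, m : nat).
pose a (m : 'I_K) x := window (gaps G x) i j
    (Num.max (tau (@kemb n K) (cK x) M K.-1 (kcut K i j m) i j) t) m.
pose b (m : 'I_K) x := window (gaps G x) i j t m.
have ve (m : 'I_K) : valid_edge (i, j, m : nat) by [].
have eF (m : 'I_K) : (i, j, m) \in full by rewrite inE.
have mg m : measurable_fun setT (g m) by exact: (measurable_gaps model).
have mother m f : f \in other_gaps K (i, j, m : nat) -> measurable_fun setT (fun x => gaps G x f).
  by move=> /other_gaps_valid; exact: (measurable_gaps model).
have ma m : measurable_fun setT (a m) by apply: measurable_cut_window => // f; exact: mother.
have mb m : measurable_fun setT (b m) by apply: measurable_window => // f; exact: mother.
have window_ge0 s m x : (0 <= window (gaps G x) i j s m)%R by rewrite le_max lexx orbT.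
have Ea m : \int[P]_x (Num.max (Num.min (g m x) (a m x)) 0)%:E = P [set x | (g m x <= a m x)%R].
  apply: (indep_exp1_min (gaps_exp model (ve m)) (ma m)); last by move=> x; exact: window_ge0.
  move=> A B mA mB.
  apply: (gap_indep model (K := K) (Y := fun g => window g i j
    (Num.max (tau (@kemb n K) (fun e => arrival_cost g (kemb e)) M K.-1 (kcut K i j m) i j) t) m)) => //.
  by move=> d' T' g'; exact: measurable_cut_window.
have Eb m : \int[P]_x (Num.max (Num.min (g m x) (b m x)) 0)%:E = P [set x | (g m x <= b m x)%R].
  apply: (indep_exp1_min (gaps_exp model (ve m)) (mb m)); last by move=> x; exact: window_ge0.
  move=> A B mA mB.
  apply: (gap_indep model (K := K) (Y := fun g => window g i j t m)) => //.
  by move=> d' T' g'; exact: measurable_window.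
have mle (f h : T -> R) : measurable_fun setT f -> measurable_fun setT h ->
    measurable [set x | (f x <= h x)%R].
  by move=> mf mh; rewrite -[X in measurable X]setTI; exact: measurable_fun_le.
(* A point inside the longer window but not the shorter one has cost in [(t, tau]], with [tau] taken
   without the later points, so [window_not_lev] applies. *)
have ab m : P [set x | (g m x <= a m x)%R] <=
    P [set x | (g m x <= b m x)%R] + P (late_edge t (i, j, m)).
  have mlate := measurable_late_edge t (eF m).
  have mgb := mle _ _ (mg m) (mb m).
  apply: le_trans (measureU2 _ mgb mlate).
  apply: ae_ge_measure; [exact: mle|exact: measurableU|].
  apply: filterS (gaps_gt0_ae model) => x gx /= ga.
  have [gb|bg] := leP (g m x) (b m x); [by left|right].
  have gm : (0 < g m x)%R := gx _ (ve m).
  have cE : cK x (i, j, m) = (arrival (gaps G x) i j m + g m x)%R.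
    by rewrite /= /arrival_cost big_ord_recr.
  have tc : (t < cK x (i, j, m))%R.
    rewrite cE; move: bg; rewrite /b /window gt_max => /andP[+ _]; lra.
  rewrite /late_edge /= tc andbT.
  apply: (window_not_lev (M := M) gx ij K0 (eF m) erefl).
  move: ga; rewrite /a /window le_max (leNgt _ 0%R) gm orbF lerBrDr addrC.
  move: tc; rewrite cE => tc; rewrite le_max => /orP[//|ct].
  by move: tc; rewrite ltNge ct.
have mmin (h : 'I_K -> T -> R) m : measurable_fun setT (h m) ->
    measurable_fun setT (fun x => (Num.max (Num.min (g m x) (h m x)) 0)%:E).
  move=> mh; apply/measurable_EFinP; apply: measurable_maxr => //; exact: measurable_minr.
have mexc : measurable_fun setT (fun x => (Num.max (tauK x M i j - t) 0)%:E).
  apply/measurable_EFinP; apply: measurable_maxr => //; apply: measurable_funB => //.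
  exact: measurable_tauK.
have ge0 (h : 'I_K -> T -> R) m x : 0 <= (Num.max (Num.min (g m x) (h m x)) 0)%:E.
  by rewrite lee_fin le_max lexx orbT.
have finb : \sum_(m < K) P [set x | (g m x <= b m x)%R] \is a fin_num.
  by apply/sum_fin_numP => m _ _; apply: fin_num_measure; exact: mle.
(* The probabilities for the windows [b] are finite, so they can be added to both sides. *)
rewrite -(leeD2rE _ _ finb) -big_split /=.
apply: (@le_trans _ _ (\sum_(m < K) P [set x | (g m x <= a m x)%R])); last first.
  by apply: lee_sum => m _; rewrite addeC; exact: ab.
under eq_bigr do rewrite -Eb.
under [leRHS]eq_bigr do rewrite -Ea.
rewrite -!ge0_integral_sum //; [|by move=> m; exact: mmin..].
rewrite -ge0_integralD //; [|by move=> x _; apply: sume_ge0|by apply: emeasurable_sum => m; exact: mmin].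
apply: ae_ge0_le_integral => //.
- by move=> x _; apply: adde_ge0 => //; exact: sume_ge0.
- by apply: emeasurable_funD => //; apply: emeasurable_sum => m; exact: mmin.
- by move=> x _; exact: sume_ge0.
- by apply: emeasurable_sum => m; exact: mmin.
apply: filterS (gaps_gt0_ae model) => x gx _.
rewrite !sumEFin -EFinD lee_fin.
have := excess_le_windows gx ij M K0 t0.
have pos (h : 'I_K -> T -> R) m : (0 <= h m x)%R ->
    Num.max (Num.min (g m x) (h m x)) 0%R = Num.min (g m x) (h m x).
  by move=> h0; apply/max_idPl; rewrite le_min h0 ltW //; exact: gx.
move=> H; apply: le_trans (le_trans _ H) _.
  by rewrite lerD2l; apply: ler_sum => m _; rewrite pos ?window_ge0.
by apply: ler_sum => m _; rewrite pos ?window_ge0.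
Qed.

Lemma sum_unordered_pairs (f : 'I_n -> 'I_n -> \bar R) : (forall r v, f r v = f v r) ->
  \sum_r \sum_(v | v != r) f r v =
  \sum_(r < n) \sum_(v < n | (r < v)%N) f r v + \sum_(r < n) \sum_(v < n | (r < v)%N) f r v.
Proof.
move=> fC; rewrite [in X in _ = _ + X](exchange_big_dep xpredT) //= -big_split /=.
apply: eq_bigr => r _; rewrite (bigID (fun v : 'I_n => (r < v)%N)) /=; congr (_ + _).
  by apply: eq_bigl => v; rewrite -val_eqE /=; case: ltngtP.
apply: eq_big => [v|v _]; last exact: fC.
by rewrite -val_eqE /=; case: ltngtP.
Qed.

(* Bounds n (w(T_K) - n t)^+ as soon as M exceeds every cost. *)
Definition spread M t x : R := (\sum_r \sum_(v | v != r) Num.max (tauK x M r v - t) 0)%R.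

Definition mean_late t : R := (\sum_(e in full) fine (P (late_edge t e)))%R.

Let excess M t r v x : \bar R := if v != r then (Num.max (tauK x M r v - t) 0)%:E else 0.

Let spreadE M t x : (spread M t x)%:E = \sum_r \sum_v excess M t r v x.
Proof.
by rewrite -sumEFin; apply: eq_bigr => r _; rewrite -sumEFin big_mkcond.
Qed.

Let measurable_excess M t r v : measurable_fun setT (excess M t r v).
Proof.
rewrite /excess; case: (v != r) => //.
apply/measurable_EFinP; apply: measurable_maxr => //; apply: measurable_funB => //.
exact: measurable_tauK.
Qed.

Let excess_pos M t r v x : 0 <= excess M t r v x.
Proof. by rewrite /excess; case: ifP. Qed.

Lemma measurable_spread M t : measurable_fun setT (fun x => (spread M t x)%:E).
Proof.
apply: (eq_measurable_fun (fun x => \sum_r \sum_v excess M t r v x)).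
  by move=> x _; rewrite spreadE.
by apply: emeasurable_sum => r; apply: emeasurable_sum => v.
Qed.

Lemma spread_ge0 M t x : (0 <= spread M t x)%R.
Proof. by apply: sumr_ge0 => r _; apply: sumr_ge0 => v _; rewrite le_max lexx orbT. Qed.

Lemma mean_lateE t : (mean_late t)%:E = \sum_(e in full) P (late_edge t e).
Proof.
rewrite /mean_late -sumEFin; apply: eq_bigr => e eF.
by rewrite fineK // fin_num_measure //; exact: measurable_late_edge.
Qed.

(** The factor 2 comes from [spread] running over ordered pairs, while each edge is counted once in
    [mean_late]. *)
Lemma mean_spread_le M t : (0 < K)%N -> (0 <= t)%R ->
  \int[P]_x (spread M t x)%:E <= (2 * mean_late t)%:E.
Proof.
move=> K0 t0; under eq_integral do rewrite spreadE.
rewrite ge0_integral_sum //; last 2 first.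
- by move=> r; apply: emeasurable_sum => v.
- by move=> r x _; exact: sume_ge0.
under eq_bigr do rewrite ge0_integral_sum //.
pose f r v := \int[P]_x (Num.max (tauK x M r v - t) 0)%:E.
have -> : \sum_r \sum_v \int[P]_x excess M t r v x = \sum_r \sum_(v | v != r) f r v.
  apply: eq_bigr => r _; rewrite [RHS]big_mkcond; apply: eq_bigr => v _.
  by rewrite /excess; case: (v != r) => //; rewrite integral0.
rewrite sum_unordered_pairs; last first.
  by move=> r v; apply: eq_integral => x _; rewrite tau_sym.
rewrite mulrDl mul1r EFinD mean_lateE.
suff : \sum_(r < n) \sum_(v < n | (r < v)%N) f r v <= \sum_(e in full) P (late_edge t e).
  by move=> h; exact: leeD.
apply: (@le_trans _ _ (\sum_(r < n) \sum_(v < n | (r < v)%N) \sum_(m < K) P (late_edge t (r, v, m)))).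
  by apply: lee_sum => r _; apply: lee_sum => v rv; exact: mean_excess.
rewrite pair_big_dep /= pair_big_dep /=.
by rewrite le_eqVlt; apply/orP; left; apply/eqP; apply: eq_big => [[[r v] m]|[[r v] m] _];
  rewrite ?inE ?andbT.
Qed.

Lemma mean_late_le t (c : R) (f : T -> R) : (0 <= c)%R ->
  measurable_fun setT (fun x => (f x)%:E) -> (forall x, (0 <= f x)%R) ->
  {ae P, forall x,
    (c * (\sum_(e in full) ((e \notin levK x) && (t < cK x e)%R)%:R) <= f x)%R} ->
  (c * mean_late t)%:E <= \int[P]_x (f x)%:E.
Proof.
move=> c0' mf f0 h.
have m1 e : measurable_fun setT
    (fun x => if e \in full then (\1_(late_edge t e) x)%:E else 0 : \bar R).
  case eF: (e \in full) => //; apply/measurable_EFinP; apply: measurable_indic.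
  exact: measurable_late_edge.
have E : (mean_late t)%:E =
    \int[P]_x \sum_e (if e \in full then (\1_(late_edge t e) x)%:E else 0).
  rewrite ge0_integral_sum //; last by move=> e x _; case: ifP => // _; rewrite lee_fin.
  rewrite mean_lateE big_mkcond; apply: eq_bigr => e _.
  case eF: (e \in full); last by rewrite integral0.
  by rewrite integral_indic ?setIT //; exact: measurable_late_edge.
have ge0 x : 0 <= \sum_e (if e \in full then (\1_(late_edge t e) x)%:E else 0 : \bar R).
  by apply: sume_ge0 => e _; case: ifP => // _; rewrite lee_fin.
have mS : measurable_fun setT
    (fun x => \sum_e (if e \in full then (\1_(late_edge t e) x)%:E else 0 : \bar R)).
  by apply: emeasurable_sum => e; exact: m1.
rewrite EFinM E -ge0_integralZl_EFin //.
apply: ae_ge0_le_integral => //.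
- by move=> x _; apply: mule_ge0; rewrite ?lee_fin.
- exact: measurable_funeM.
- by move=> x _; rewrite lee_fin.
apply: filterS h => x h _; apply: le_trans (_ : _ <= (c * (\sum_(e in full)
  ((e \notin levK x) && (t < cK x e)%R)%:R))%:E) _; last by rewrite lee_fin.
rewrite EFinM; apply: lee_wpmul2l; first by rewrite lee_fin.
rewrite -sumEFin [leRHS]big_mkcond; apply: lee_sum => e _; case: ifP => // _.
rewrite lee_fin indicE ler_nat.
by have [/set_mem -> //|//] := boolP (x \in late_edge t e).
Qed.

End MeanExcess.

(** * Uniform integrability of the tree weight *)

Section TreeWeight.
Local Open Scope ereal_scope.
Context d (T : measurableType d) (R : realType) (P : probability T R).
Variables (n K : nat) (G : 'I_n -> 'I_n -> nat -> T -> R) (W : T -> R).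
Hypotheses (n0 : (0 < n)%N) (K0 : (0 < K)%N).
Hypothesis model : poisson_multigraph P G.
Hypothesis mW : measurable_fun setT W.
Hypothesis weightW : {ae P, forall x, exists Ts : seq (seq (medge n)),
  [/\ size Ts = K, successive_msts (edge_cost G x) Ts &
      W x = weight (edge_cost G x) (nth [::] Ts K.-1)]}.

Notation full := (kfull n K).
Notation c x := (arrival_cost (gaps G x)).
Notation levK x := (lev (@kemb n K) (fun e => c x (kemb e)) K full).

Let mean_cst (r : R) : \int[P]_x r%:E = r%:E.
Proof.
apply: eq_trans (integral_cst P measurableT r%:E) _.
by rewrite -[RHS]mule1; congr (_ * _); exact: probability_setT.
Qed.

(** The almost sure event on which the deterministic results on Kruskal layers apply; [c x] is
    [edge_cost G x] by unfolding. *)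
Let good x := exists Ts : seq (seq (medge n)),
  [/\ size Ts = K, successive_msts (c x) Ts & W x = weight (c x) (nth [::] Ts K.-1)] /\
  [/\ (forall e, valid_edge e -> 0 < c x e)%R,
      (forall (i j : 'I_n) m, (i < j)%N -> c x (i, j, m) < c x (i, j, m.+1))%R &
      {in full &, injective (fun e => c x (kemb e))}].

Let good_ae : {ae P, forall x, good x}.
Proof.
apply: filterS3 (gaps_gt0_ae model) (kcost_inj_ae K model) weightW => x g0 ci [Ts Tsx].
exists Ts; split=> //; split=> // [[[i j] m] ve|i j m ij]; last exact: arrival_cost_lt.
rewrite /arrival_cost big_ord_recr /=; apply: ltr_wpDl; last exact: g0.
by apply: sumr_ge0 => l _; apply/ltW/g0.
Qed.

(** Origin of the constant: at level 0 at most K n late edges are expected, so the mean spread is at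
    most 2 K n; Markov then leaves at most 2 K^2 / t late edges at level t, and passing back to the
    spread doubles this. *)
Let spread_bound M t : (0 < t)%R -> (t < M)%R ->
  \int[P]_x (spread K G M t x)%:E <= (4 * K%:R ^+ 2 / t)%:E.
Proof.
move=> t0 tM; have M0 : (0 < M)%R by exact: lt_trans tM.
have nR : (0 < n%:R :> R)%R by rewrite ltr0n.
(* Each of the fewer than n * n ordered pairs contributes at most 1. *)
have late0 : (n%:R * mean_late P K G 0 <= K%:R * n%:R * n%:R)%R.
  rewrite -lee_fin.
  have -> : (K%:R * n%:R * n%:R)%:E = \int[P]_x (K%:R * n%:R * n%:R : R)%:E.
    by rewrite mean_cst.
  apply: (mean_late_le model (f := fun=> (K%:R * n%:R * n%:R)%R)) => //.
  apply: filterS good_ae => x [Ts [[sz mst _] [h1 h2 h3]]].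
  apply: le_trans (sum_not_lev_le h1 h2 h3 sz mst M0) _.
  rewrite -mulrA ler_wpM2l // -natrM -[X in (X * n)%N]card_ord -sum_nat_const natr_sum.
  apply: ler_sum => r _; apply: (@le_trans _ _ (\sum_(v < n) 1)%R).
    2: by rewrite sumr_const card_ord.
  rewrite [leRHS](bigID (fun v => v != r)) /= ler_wpDr ?sumr_ge0 //.
  by apply: ler_sum => v _; rewrite lern1 leq_b1.
have S0 := mean_spread_le model M K0 (lexx 0%R).
(* Markov's inequality, applied pointwise: t times the indicator of [t < tau] is at most the
   positive part of [tau]. *)
have late_t : ((t * n%:R * mean_late P K G t)%:E <= \int[P]_x (K%:R * spread K G M 0 x)%:E).
  apply: (mean_late_le model (f := fun x => (K%:R * spread K G M 0 x)%R)).
  - by rewrite mulr_ge0 // ltW.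
  - apply: (eq_measurable_fun (fun x => K%:R%:E * (spread K G M 0 x)%:E)) => //.
    by apply: measurable_funeM; exact: (@measurable_spread _ _ _ P n K G model).
  - by move=> x; rewrite mulr_ge0 // spread_ge0.
  apply: filterS good_ae => x [Ts [[sz mst _] [h1 h2 h3]]].
  have := ler_wpM2l (ltW t0) (sum_not_lev_le h1 h2 h3 sz mst tM).
  rewrite mulrA => h; apply: le_trans h _; rewrite mulrCA ler_wpM2l //.
  rewrite mulr_sumr; apply: ler_sum => r _; rewrite mulr_sumr; apply: ler_sum => v _.
  have [tt|_] := ltP t _; last by rewrite mulr0 le_max lexx orbT.
  by rewrite mulr1 subr0 le_max ltW.
have : (t * n%:R * mean_late P K G t <= K%:R * (2 * mean_late P K G 0))%R.
  rewrite -lee_fin; apply: le_trans late_t _.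
  under eq_integral do rewrite EFinM.
  rewrite ge0_integralZl_EFin //; last 2 first.
  - by move=> x _; rewrite lee_fin spread_ge0.
  - exact: (@measurable_spread _ _ _ P n K G model).
  by rewrite EFinM; apply: lee_wpmul2l.
have St := mean_spread_le model M K0 (ltW t0).
move=> lt; apply: le_trans St _; rewrite lee_fin ler_pdivlMr //.
have l0 : (mean_late P K G 0 <= K%:R * n%:R)%R.
  by rewrite -(ler_pM2l nR) mulrCA mulrA [leRHS](_ : _ = K%:R * n%:R * n%:R)%R //; ring.
have : (t * n%:R * mean_late P K G t <= K%:R * (2 * (K%:R * n%:R)))%R.
  by apply: le_trans lt _; rewrite ler_wpM2l // ler_wpM2l.
move=> h; have : (t * mean_late P K G t <= 2 * K%:R ^+ 2)%R; last by lra.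
rewrite -(ler_pM2l nR) [leLHS](_ : _ = t * n%:R * mean_late P K G t)%R; last by ring.
by rewrite [leRHS](_ : _ = K%:R * (2 * (K%:R * n%:R)))%R //; ring.
Qed.

Lemma weight_ge0_ae : {ae P, forall x, (0 <= W x)%R}.
Proof.
apply: filterS good_ae => x [Ts [[sz mst ->] [h1 _ _]]].
rewrite /weight big_seq; apply: sumr_ge0 => e eT; apply/ltW/h1.
by apply: (mst_valid sz mst _ eT); rewrite prednK.
Qed.

(** No fixed cap exceeds all the random costs. The cap therefore runs through the integers, where
    [spread] increases and monotone convergence applies; for almost every outcome it finally exceeds
    every cost. *)
Lemma mean_weight_excess C : (0 < C)%R ->
  \int[P]_x (Num.max (W x - C) 0)%:E <= (4 * K%:R ^+ 2 / C)%:E.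
Proof.
move=> C0; have nR : (0 < n%:R :> R)%R by rewrite ltr0n.
(* A tree has at most [n] edges, so lowering each cost by C / n lowers the weight by at most C. *)
pose t : R := (C / n%:R)%R.
have t0 : (0 < t)%R by rewrite divr_gt0.
pose f (p : nat) x : \bar R := (spread K G p%:R t x)%:E.
have mf p : measurable_fun setT (f p) by exact: (@measurable_spread _ _ _ P n K G model).
have f0 p x : 0 <= f p x by rewrite lee_fin spread_ge0.
have ndf x : {homo f^~ x : p q / (p <= q)%N >-> p <= q}.
  move=> p q pq; rewrite lee_fin; apply: ler_sum => r _; apply: ler_sum => v _.
  by rewrite ge_max !le_max lexx lerD2r tau_cap_mono ?ler_nat ?orbT.
have mmax : measurable_fun setT (fun x => (Num.max (W x - C) 0)%:E : \bar R).
  by apply/measurable_EFinP; apply: measurable_maxr => //; exact: measurable_funB.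
have lim_bound : limn (fun p => \int[P]_x f p x) <= (4 * K%:R ^+ 2 / t)%:E.
  apply: lime_le.
    apply: ereal_nondecreasing_is_cvgn => p q pq.
    by apply: ge0_le_integral => // x _; exact: ndf.
  near=> p; apply: spread_bound => //.
  near: p; exact: nbhs_infty_gtr.
have : n%:R%:E * \int[P]_x (Num.max (W x - C) 0)%:E <= (4 * K%:R ^+ 2 / t)%:E.
  apply: le_trans lim_bound.
  have nd : forall x, setT x -> {homo f^~ x : p q / (p <= q)%N >-> p <= q} by move=> x _.
  have f0' : forall p x, setT x -> 0 <= f p x by move=> p x _.
  rewrite -(monotone_convergence P measurableT mf f0' nd).
  rewrite -ge0_integralZl_EFin //; last by move=> x _; rewrite lee_fin le_max lexx orbT.
  apply: ae_ge0_le_integral => //.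
  - by move=> x _; rewrite mule_ge0 // lee_fin le_max lexx orbT.
  - exact: measurable_funeM.
  - move=> x _; apply: lime_ge; last by near=> p.
    by apply: ereal_nondecreasing_is_cvgn; exact: ndf.
  - apply: (emeasurable_fun_cvg f) => // x _.
    by apply: ereal_nondecreasing_is_cvgn; exact: ndf.
  apply: filterS good_ae => x [Ts [[sz mst Wx] [h1 h2 h3]]] _.
  apply: lime_ge; first by apply: ereal_nondecreasing_is_cvgn; exact: ndf.
  near=> p; rewrite /f -EFinM lee_fin Wx.
  apply: (mst_weight_le h1 h2 h3 sz mst K0 _ (ltW t0)).
    by rewrite /t mulrCA divff ?mulr1 // gt_eqF.
  (* The total cost of the finite edge set bounds every single cost. *)
  move=> e eF; apply: (@le_trans _ _ (\sum_(e in full) c x (kemb e))%R).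
    rewrite (bigD1 e) //= lerDl; apply: sumr_ge0 => f' /andP[fF _].
    by apply/ltW/h1; rewrite inE in fF.
  near: p; exact: nbhs_infty_ger.
rewrite /t; have -> : (4 * K%:R ^+ 2 / (C / n%:R) = n%:R * (4 * K%:R ^+ 2 / C) :> R)%R.
  by field; rewrite !gt_eqF.
by rewrite EFinM lee_pmul2l // lte_fin.
Unshelve. all: by end_near. Qed.

(** Off the event [A] the distance is below [eps]. On it, the distance is at most [W x + |gamma|],
    and [W x] is at most [C] plus its excess over [C]. *)
Lemma mean_dist_le (gamma eps C : R) : (0 < eps)%R -> (0 < C)%R ->
  \int[P]_x (`|W x - gamma|)%:E <=
  eps%:E + (C + `|gamma|)%:E * P [set x | (eps <= `|W x - gamma|)%R]
    + (4 * K%:R ^+ 2 / C)%:E.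
Proof.
move=> e0 C0; set A := [set x | _].
have mD : measurable_fun setT (fun x => `|W x - gamma|%R).
  by apply: measurableT_comp => //; exact: measurable_funB.
have mDE : measurable_fun setT (fun x => (`|W x - gamma|)%:E : \bar R).
  exact/measurable_EFinP.
have mA : measurable A.
  by rewrite -[X in measurable X]setTI; apply: measurable_fun_le.
have Cg : (0 <= C + `|gamma|)%R by rewrite addr_ge0 // ltW.
have mmax : measurable_fun setT (fun x => (Num.max (W x - C) 0)%:E : \bar R).
  by apply/measurable_EFinP; apply: measurable_maxr => //; exact: measurable_funB.
have mind : measurable_fun setT (fun x => ((C + `|gamma|) * \1_A x)%:E : \bar R).
  by apply/measurable_EFinP; apply: measurable_funM => //.
have ind0 x : 0 <= ((C + `|gamma|) * \1_A x)%:E by rewrite lee_fin mulr_ge0.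
have max0 x : 0 <= (Num.max (W x - C) 0)%:E by rewrite lee_fin le_max lexx orbT.
have sum0 x : 0 <= eps%:E + ((C + `|gamma|) * \1_A x)%:E.
  by rewrite adde_ge0 // lee_fin ltW.
apply: (@le_trans _ _ (\int[P]_x (eps%:E + ((C + `|gamma|) * \1_A x)%:E +
    (Num.max (W x - C) 0)%:E))).
  apply: ae_ge0_le_integral => //.
  - by move=> x _; apply: adde_ge0.
  - by apply: emeasurable_funD => //; exact: emeasurable_funD.
  apply: filterS weight_ge0_ae => x W0 _; rewrite -!EFinD lee_fin indicE.
  have [xA|xA] := boolP (x \in A); last first.
    have : (`|W x - gamma| < eps)%R.
      by rewrite ltNge; apply: contra xA => h; apply/mem_set.
    have := max0 x; rewrite lee_fin mulr0; lra.
  have h : (`|W x - gamma| <= W x + `|gamma|)%R.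
    by apply: le_trans (ler_normB _ _) _; rewrite ger0_norm.
  have h2 : (W x - C <= Num.max (W x - C) 0)%R by rewrite le_max lexx.
  by rewrite mulr1; lra.
rewrite ge0_integralD //; last exact: emeasurable_funD.
apply: leeD; last exact: mean_weight_excess.
rewrite ge0_integralD //; last by move=> x _; rewrite lee_fin ltW.
rewrite mean_cst; apply: leeD2l.
under eq_integral do rewrite EFinM.
by rewrite ge0_integralZl_EFin ?integral_indic ?setIT //; exact/measurable_EFinP.
Qed.

(** Finiteness of the mean is part of the conclusion because convergence to a real limit in the
    extended reals asks for it. *)
Lemma mean_error_le (gamma b : R) : \int[P]_x (`|W x - gamma|)%:E <= b%:E ->
  \int[P]_x (W x)%:E \is a fin_num /\ (`|gamma - fine (\int[P]_x (W x)%:E)| <= b)%R.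
Proof.
move=> h.
have mD : measurable_fun setT (fun x => W x - gamma)%R by exact: measurable_funB.
have iD : P.-integrable setT (EFin \o (fun x => W x - gamma)%R).
  apply/integrableP; split; first exact/measurable_EFinP.
  by apply: le_lt_trans h _; exact: ltry.
have ic : P.-integrable setT (EFin \o (fun=> gamma)).
  exact: finite_measure_integrable_cst.
have iW : P.-integrable setT (EFin \o W).
  apply: (eq_integrable _ ((EFin \o (fun x => W x - gamma)%R) \+ (EFin \o (fun=> gamma)))) => //.
    by move=> x _ /=; rewrite -EFinD subrK.
  exact: integrableD.
have fW : \int[P]_x (W x)%:E \is a fin_num by exact: integrable_fin_num.
split=> //; rewrite distrC -lee_fin; apply: le_trans h.
have -> : (`|fine (\int[P]_x (W x)%:E) - gamma|)%:E = `|\int[P]_x (W x - gamma)%:E|.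
  have -> : \int[P]_x (W x - gamma)%:E = \int[P]_x (W x)%:E - gamma%:E.
    under eq_integral do rewrite EFinB.
    by rewrite integralB_EFin // mean_cst.
  by rewrite -[in RHS](fineK fW) -EFinB abse_EFin.
by apply: le_abse_integral => //; exact/measurable_EFinP.
Qed.

End TreeWeight.

(** * Convergence of the means *)

Theorem theorem1p3 (d : measure_display) (T : measurableType d) (R : realType)
  (P : probability T R)
  (G : forall n : nat, 'I_n -> 'I_n -> nat -> T -> R)
  (k : nat) (W : nat -> T -> R) (gamma : R) :
  (0 < k)%N ->
  (forall n, poisson_multigraph P (G n)) ->
  (forall n, measurable_fun setT (W n)) ->
  (* W n = w(T_k) in the model on [n] (almost surely) *)
  (forall n, {ae P, forall x, exists Ts : seq (seq (medge n)),
     [/\ size Ts = k, successive_msts (edge_cost (G n) x) Ts &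
         W n x = weight (edge_cost (G n) x) (nth [::] Ts k.-1)]}) ->
  (* gamma = gamma_k is the limit in probability of w(T_k) *)
  (forall eps : R, 0 < eps ->
     (fun n => P [set x | eps <= `|W n x - gamma|]) @ \oo --> 0%E) ->
  (* then E w(T_k) -> gamma_k *)
  (fun n => (\int[P]_x (W n x)%:E)%E) @ \oo --> gamma%:E.
Proof.
move=> k0 model mW weightW cvgW.
apply/fine_cvgP; suff main : forall dlt : R, 0 < dlt -> \forall n \near \oo,
    (\int[P]_x (`|W n x - gamma|)%:E <= dlt%:E)%E.
  split.
    apply: filterS (main 1 ltr01) => n h; exact: (mean_error_le (mW n) h).1.
  apply/cvgrPdist_le => dlt d0; apply: filterS (main dlt d0) => n h.
  exact: (mean_error_le (mW n) h).2.
move=> dlt d0.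
have k2 : 0 < k%:R ^+ 2 :> R by rewrite exprn_gt0 // ltr0n.
(* With this [C] the excess term [4 * k%:R ^+ 2 / C] is exactly one third of [dlt]; the other two
   thirds go to [eps] and to the probability term. *)
pose C : R := 12 * k%:R ^+ 2 / dlt.
have C0 : 0 < C by rewrite divr_gt0 // mulr_gt0.
have Cg : 0 < C + `|gamma| by rewrite ltr_wpDr.
have d3 : 0 < dlt / 3 by rewrite divr_gt0.
have /fine_cvgP[_ /cvgrPdist_le cvgP0] := cvgW _ d3.
have q0 : 0 < dlt / 3 / (C + `|gamma|) by rewrite divr_gt0.
near=> n.
have n0 : (0 < n)%N by near: n; exact: nbhs_infty_gt.
have : `|0 - fine (P [set x | dlt / 3 <= `|W n x - gamma|])| <= dlt / 3 / (C + `|gamma|).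
  by near: n; exact: cvgP0 q0.
set A := [set x | dlt / 3 <= `|W n x - gamma|].
have mA : measurable A.
  rewrite -[X in measurable X]setTI; apply: measurable_fun_le => //.
  by apply: measurableT_comp => //; exact: measurable_funB.
rewrite sub0r normrN ger0_norm ?fine_ge0 // => PA.
apply: le_trans (mean_dist_le n0 k0 (model n) (mW n) (weightW n) gamma d3 C0) _.
have -> : P A = (fine (P A))%:E by rewrite fineK // fin_num_measure.
rewrite -EFinM -!EFinD lee_fin.
have -> : 4 * k%:R ^+ 2 / C = dlt / 3.
  by rewrite /C; field; rewrite !gt_eqF // ltr0n.
have : (C + `|gamma|) * fine (P A) <= dlt / 3.
  apply: le_trans (ler_wpM2l (ltW Cg) PA) _.
  by rewrite mulrC divfK // gt_eqF.
lra.
Unshelve. all: by end_near. Qed.
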